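(* Let $a\in\mathbb N$, $a\ge1$, let $\Lambda$ be the Lyapunov function, let $x(a,\frac pq)$, $\frac pq\in[0,\frac12]\cap\mathbb Q$, be the generalised Markov-Hurwitz numbers with parameter $a$, and let $\mathbb X_a=\{x(a,\frac pq):\frac pq\in[0,\frac12]\cap\mathbb Q\}$. Then for all $a\in\mathbb N$ the function $\Lambda(x(a,\frac pq))$ is convex as a function of $\frac pq\in[0,\frac12]\cap\mathbb Q$, and the restriction of $\Lambda$ to the set $\mathbb X_a$ is monotonically increasing.
   Context: Continued fractions: $[a_1,a_2,\dots]:=\cfrac{1}{a_1+\cfrac{1}{a_2+\dots}}$, with positive integers $a_i$; an overline denotes a period. Generalised Markov-Hurwitz numbers. Fix an integer $a\ge1$. To each rational $r\in[0,\frac12]$ assign a finite word $P_a(r)$ in the letters $a,2a$: $P_a(\frac01)=(a,a)$, $P_a(\frac12)=(2a,2a)$, and if $\frac pq<\frac{p'}{q'}$ are fractions in $[0,\frac12]$ with $p'q-pq'=1$, then $P_a\left(\frac{p+p'}{q+q'}\right)=P_a(\frac{p'}{q'})P_a(\frac pq)$ (concatenation, the word of the larger fraction first). This defines $P_a$ on all rationals in $[0,\frac12]$. Put $x(a,r)=[\overline{P_a(r)}]\in(0,1)$, i.e. $x(a,r)=y(a,r)^{-1}$, where $y(a,r)>1$ is the quadratic irrational whose usual continued fraction expansion (with integer part equal to the first letter) is purely periodic with period $P_a(r)$. Lyapunov function. Let $L=\begin{pmatrix}1&1\\0&1\end{pmatrix}$, $R=\begin{pmatrix}1&0\\1&1\end{pmatrix}$.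 For real $x\ge 0$ define matrices $A_n(x)=\begin{pmatrix}a_n&b_n\\c_n&d_n\end{pmatrix}$ by $A_0(x)=I$ and $A_{n+1}(x)=A_n(x)R$ if $x<\frac{a_n+b_n}{c_n+d_n}$, $A_{n+1}(x)=A_n(x)L$ if $x>\frac{a_n+b_n}{c_n+d_n}$ (equality never occurs for irrational $x$; all elements of $\mathbb X_a$ are irrational). Let $w_n(x)$ be the largest entry of $A_n(x)$ (for $x\in[0,1)$, $n\ge1$, it is $\max(c_n,d_n)$). Then $\Lambda(x)=\limsup_{n\to\infty}\frac{\ln w_n(x)}{n}$. *)

(* Defs.v *)
From mathcomp Require Import all_boot all_order all_algebra.
From mathcomp Require Import all_classical all_reals all_analysis.
From mathcomp Require Import zify.

Set Implicit Arguments.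
Unset Strict Implicit.
Unset Printing Implicit Defensive.

Import Order.TTheory GRing.Theory Num.Theory.
Import numFieldNormedType.Exports.

Local Open Scope ring_scope.

(* The word of x/y is found by descending the Farey tree: [p/q, p'/q'] is a
   Farey interval containing x/y whose ends carry the words u and v, and the
   mediant carries v ++ u.  The counter n only bounds the recursion: starting
   from [0/1, 1/2], n = y steps are enough when x/y is reduced, because q + q'
   starts at 3 and grows at each step. *)
Fixpoint farey_search (n x y p q : nat) (u : seq nat) (p' q' : nat)
    (v : seq nat) : seq nat :=
  if n is k.+1 then
    if (x * q == p * y)%N then u
    else if (x * q' == p' * y)%N then v
    else if (x * (q + q') < (p + p') * y)%N
         then farey_search k x y p q u (p + p') (q + q') (v ++ u)
         else farey_search k x y (p + p') (q + q') (v ++ u) p' q' v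
  else [::].

(* P_a(r); only meaningful for 0 <= r <= 1/2.  It satisfies the defining
   recursion: see mh_word0, mh_word_half and mh_word_mediant below. *)
Definition mh_word (a : nat) (r : rat) : seq nat :=
  farey_search `|denq r|%N `|numq r|%N `|denq r|%N
    0 1 [:: a; a] 1 2 [:: (2 * a)%N; (2 * a)%N].

(* cf_conv [:: a1; ...; an] is the finite continued fraction [a1, ..., an]. *)
Definition cf_conv (R : realType) (s : seq nat) : R :=
  foldr (fun (k : nat) (t : R) => (k%:R + t)^-1) 0 s.

(* [a1, a2, ...], with u i standing for a_(i+1). *)
Definition cf (R : realType) (u : nat -> nat) : R :=
  limn (fun n => cf_conv R (mkseq u n)).

Definition periodic_cf (R : realType) (s : seq nat) : R :=
  cf R (fun i => nth 0%N s (i %% size s)).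

Definition mh_number (R : realType) (a : nat) (r : rat) : R :=
  periodic_cf R (mh_word a r).

Definition half_interval (r : rat) : bool := 0 <= r <= 1 / 2%:R.

Definition mh_set (R : realType) (a : nat) : set R :=
  [set x | exists2 r : rat, half_interval r & x = mh_number R a r]%classic.

Arguments mh_set : clear implicits.

Definition matL : 'M[nat]_2 :=
  \matrix_(i, j) (if (i == 1) && (j == 0) then 0%N else 1%N).
Definition matR : 'M[nat]_2 :=
  \matrix_(i, j) (if (i == 0) && (j == 1) then 0%N else 1%N).

(* The tie x = (a_n + b_n) / (c_n + d_n), which only occurs for rational x,
   is sent to the L branch. *)
Fixpoint path_mx (R : realType) (x : R) (n : nat) : 'M[nat]_2 :=
  if n is k.+1 then
    let A := path_mx x k in
    if x < (A 0 0 + A 0 1)%:R / (A 1 0 + A 1 1)%:R then A *m matR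
    else A *m matL
  else 1%:M.

Definition max_entry (A : 'M[nat]_2) : nat :=
  (\max_(i < 2) \max_(j < 2) A i j)%N.

(* The real-valued limsup is the intended one: 1 <= w_n <= 2 ^ n for n >= 1,
   so the sequence is bounded. *)
Definition Lyapunov (R : realType) (x : R) : R :=
  limn_sup (fun n => ln (max_entry (path_mx x n))%:R / n%:R).

Lemma matLE : [/\ matL 0 0 = 1%N, matL 0 1 = 1%N, matL 1 0 = 0%N & matL 1 1 = 1%N].
Proof. by rewrite !mxE. Qed.

Lemma matRE : [/\ matR 0 0 = 1%N, matR 0 1 = 0%N, matR 1 0 = 1%N & matR 1 1 = 1%N].
Proof. by rewrite !mxE. Qed.

Lemma farey_search_fuel (n m x y p q p' q' : nat) (u v : seq nat) :
  (p' * q = p * q' + 1)%N -> (0 < q)%N -> (0 < q')%N -> (0 < y)%N ->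
  (p * y <= x * q)%N -> (x * q' <= p' * y)%N ->
  (0 < n)%N -> (0 < m)%N ->
  (y + 2 <= n + q + q')%N -> (y + 2 <= m + q + q')%N ->
  farey_search n x y p q u p' q' v = farey_search m x y p q u p' q' v.
Proof.
elim: n m p q p' q' u v => [|n IHn] [|m] p q p' q' u v //=.
move=> det q0 q'0 y0 lex gex _ _ len lem.
case: eqP => // neq; case: eqP => // neq'.
have ley : (q + q' <= y)%N.
  have h1 : (p * y + 1 <= x * q)%N by lia.
  have h2 : (x * q' + 1 <= p' * y)%N by lia.
  have e : (q * (p' * y) + q' * (x * q) = q * (x * q') + q' * (p * y) + y)%N.
    nia.
  nia.
by case: ltnP => h; apply: IHn; nia.
Qed.

Lemma farey_between (x y x' y' s t : nat) :
  (x' * y = x * y' + 1)%N -> (x * t < s * y)%N -> (s * y' < x' * t)%N ->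
  (y + y' <= t)%N.
Proof.
move=> det h1 h2.
have e : (y * (x' * t) = y' * (x * t) + t)%N by nia.
have l1 : (y' * (x * t) + y' <= y' * (s * y))%N by nia.
have l2 : (y * (s * y') + y <= y * (x' * t))%N by nia.
nia.
Qed.

Lemma farey_search_mediant (n x y x' y' p q p' q' : nat) (u v : seq nat) :
  (p' * q = p * q' + 1)%N -> (0 < q)%N -> (0 < q')%N ->
  (x' * y = x * y' + 1)%N -> (0 < y)%N -> (0 < y')%N ->
  (p * y <= x * q)%N -> (x' * q' <= p' * y')%N ->
  (y + y' + 2 <= n + q + q')%N ->
  farey_search n (x + x') (y + y') p q u p' q' v =
  farey_search n x' y' p q u p' q' v ++ farey_search n x y p q u p' q' v.
Proof.
elim: n p q p' q' u v => [|n IHn] p q p' q' u v det q0 q'0 det' y0 y'0 lex gex len.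
all: have lx' : (p * y' < x' * q)%N.
1,3: by rewrite -(ltn_pmul2l y0); nia.
all: have gx : (x * q' < p' * y)%N.
1,3: by rewrite -(ltn_pmul2l y'0); nia.
all: have lm : (p * (y + y') < (x + x') * q)%N by nia.
all: have gm : ((x + x') * q' < p' * (y + y'))%N by nia.
all: have ley : (q + q' <= y + y')%N by exact: (farey_between det lm gm).
  lia.
case: n IHn len => [|n] IHn len; first by lia.
have detl : ((p + p') * q = p * (q + q') + 1)%N by nia.
have detr : (p' * (q + q') = (p + p') * q' + 1)%N by nia.
have [F defF] : exists F, F = n.+1 by exists n.+1.
rewrite -defF in IHn len *.
rewrite [farey_search _.+1 (x + x') _ _ _ _ _ _ _]/=.
rewrite ifN; last by apply/eqP; lia.
rewrite ifN; last by apply/eqP; lia.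
case: (ltngtP ((x + x') * (q + q')) ((p + p') * (y + y'))) => cmp.
- have hx' : (x' * (q + q') <= (p + p') * y')%N.
    rewrite leqNgt; apply/negP => h.
    have hx : (x * (q + q') < (p + p') * y)%N by nia.
    have := farey_between det' hx h; nia.
  rewrite IHn //; try lia; congr cat.
  + rewrite [RHS]/= ifN; last by apply/eqP; lia.
    rewrite ifN; last first.
      apply/eqP => h.
      have : (p' * (q + q') <= (p + p') * q')%N; last by lia.
      by rewrite -(leq_pmul2l y'0); nia.
    case: ltnP => h //.
    have e : (x' * (q + q') = (p + p') * y')%N by lia.
    by rewrite defF /= e eqxx ifN //; apply/eqP; lia.
  + rewrite [RHS]/=.
    have [h|h] := boolP (x * q == p * y)%N; first by rewrite defF /= h.
    rewrite ifN; last by apply/eqP; lia.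
    rewrite ifT //.
    rewrite -(ltn_pmul2l y'0); nia.
- have hx : ((p + p') * y <= x * (q + q'))%N.
    rewrite leqNgt; apply/negP => h.
    have hx' : ((p + p') * y' < x' * (q + q'))%N by nia.
    have := farey_between det' h hx'; nia.
  have hx' : ((p + p') * y' < x' * (q + q'))%N.
    by rewrite -(ltn_pmul2l y0); nia.
  rewrite IHn //; try lia; congr cat.
  + rewrite [RHS]/= ifN; last by apply/eqP; lia.
    have [h|h] := boolP (x' * q' == p' * y')%N.
      by rewrite defF /= h ifN //; apply/eqP; lia.
    by rewrite ifN //; lia.
  + rewrite [RHS]/=.
    rewrite ifN; last first.
      apply/eqP => h.
      have : ((p + p') * q <= p * (q + q'))%N; last by lia.
      by rewrite -(leq_pmul2l y0); nia.
    rewrite ifN; last by apply/eqP; lia.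
    by rewrite ifN //; lia.
- have e1 : ((y + y') * ((p + p') * y) = (y + y') * (x * (q + q')) + (q + q'))%N.
    by nia.
  have e2 : (x * (q + q') < (p + p') * y)%N by rewrite ltnNge; apply/negP => h; nia.
  have e3 : (y + y' = q + q')%N by nia.
  have e4 : (x + x' = p + p')%N by nia.
  have e5 : (x * q = p * y)%N by nia.
  have e6 : (x' * q' = p' * y')%N by nia.
  rewrite [RHS]/= e5 eqxx e6 eqxx ifN; last by apply/eqP; lia.
  by rewrite defF /= e4 e3 eqxx.
Qed.

Lemma mh_word0 (a : nat) : mh_word a 0 = [:: a; a].
Proof. by []. Qed.

Lemma mh_word_half (a : nat) : mh_word a (1 / 2%:R) = [:: (2 * a)%N; (2 * a)%N].
Proof.
have -> : (1 / 2%:R : rat) = 1%:Z%:~R / 2%:Z%:~R by [].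
by rewrite /mh_word coprimeq_num // coprimeq_den.
Qed.

Lemma mh_wordE (a p q n : nat) : (coprime p q) -> (0 < q)%N -> (2 * p <= q)%N ->
  (0 < n)%N -> (q <= n.+1)%N ->
  mh_word a (p%:R / q%:R) =
  farey_search n p q 0 1 [:: a; a] 1 2 [:: (2 * a)%N; (2 * a)%N].
Proof.
move=> cpq q0 le2 n0 leqn.
have cpq' : coprime `|p%:Z| `|q%:Z| by rewrite !absz_nat.
have -> : (p%:R / q%:R : rat) = p%:Z%:~R / q%:Z%:~R by [].
rewrite /mh_word coprimeq_num // coprimeq_den //.
have -> : (q%:Z == 0) = false by lia.
rewrite gtr0_sg ?ltz_nat // mul1r !absz_nat.
by apply: farey_search_fuel; lia.
Qed.

Lemma mh_word_mediant (a p q p' q' : nat) :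
  (0 < q)%N -> (0 < q')%N -> (p' * q = p * q' + 1)%N -> (2 * p' <= q')%N ->
  mh_word a ((p + p')%:R / (q + q')%:R) =
  mh_word a (p'%:R / q'%:R) ++ mh_word a (p%:R / q%:R).
Proof.
move=> q0 q'0 det le2.
have le2' : (2 * p <= q)%N by rewrite -(leq_pmul2l q'0); nia.
have cop u v u' v' : (u' * v = u * v' + 1)%N -> coprime u v.
  move=> d; rewrite /coprime -dvdn1.
  rewrite -(@dvdn_addr (u * v')); first by rewrite -d dvdn_mull // dvdn_gcdr.
  by rewrite dvdn_mulr // dvdn_gcdl.
have cop' u v u' v' : (u' * v = u * v' + 1)%N -> coprime u' v'.
  move=> d; rewrite /coprime -dvdn1.
  rewrite -(@dvdn_addr (u * v')); first by rewrite -d dvdn_mulr // dvdn_gcdl.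
  by rewrite dvdn_mull // dvdn_gcdr.
rewrite !(@mh_wordE a _ _ (q + q')) //; try lia.
- by apply: farey_search_mediant => //; lia.
- exact: cop det.
- exact: cop' det.
- by apply: (cop _ _ p' q'); lia.
Qed.

(* Main.v *)
(* For an even word w with positive letters, [w, w, ...] is fixed by the product
   M(w) of the matrices [[0, 1], [1, k]] over the letters k of w, and the L/R path
   of that number is periodic with period M(w) of length the sum of the letters.
   Hence Lambda = (log of the spectral radius of M(w)) / (sum of the letters), where
   the sum of the letters of P_a(p/q) is 2 a q.

   Convexity.  Let w be the mediant of Farey neighbours with matrices X (left) and
   Y (right), and let C = Y X be its matrix.  In an eigenbasis C is diag(m, 1/m), and
   X has diagonal entries al, be with al be >= 1: this amounts to tr [X, Y] <= 2, and
   tr [X, Y] = 2 - 4 a ^ 6 is constant along the tree.  After a sign change of the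
   basis, X is then entrywise nonnegative, while Y = C X^-1 is nonnegative up to the
   sign of its off-diagonal entries.  Every fraction left of w has as matrix a product
   of factors X, C, 1/C, so its (0, 0) entry is at least the corresponding monomial in
   al, m, and similarly on the right.  Taking logarithms, the log of the spectral
   radius dominates a linear functional of (p, q) with equality at w.

   Monotonicity.  p/q |-> x(a, p/q) is nonincreasing since the continued fraction maps
   of even words are increasing contractions.  A convex function of p/q that is
   smaller at 1/2 than elsewhere is strictly decreasing, and a computation in the
   eigenbasis of P_a(1/2) gives that strict minimum. *)
Require Import Defs.
From mathcomp Require Import all_boot all_order all_algebra.
From mathcomp Require Import all_classical all_reals all_analysis.
From mathcomp Require Import zify ring lra.

Set Implicit Arguments.
Unset Strict Implicit.
Unset Printing Implicit Defensive.

Import Order.TTheory GRing.Theory Num.Theory.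
Import numFieldNormedType.Exports.

Local Open Scope classical_set_scope.
Local Open Scope ring_scope.


(** * Even words and their L/R paths *)

Lemma mulmx2E (R : pzSemiRingType) (A B : 'M[R]_2) i j :
  (A *m B) i j = A i 0 * B 0 j + A i 1 * B 1 j.
Proof.
rewrite mxE big_ord_recl big_ord1.
by congr (A i _ * B _ j + A i _ * B _ j); apply: val_inj.
Qed.

Lemma forall_ord2 (P : 'I_2 -> Prop) : P 0 -> P 1 -> forall i, P i.
Proof.
move=> P0 P1 i; case: (unliftP 0 i) => [j ->|-> //].
by rewrite (_ : lift 0 j = 1) //; apply: val_inj; rewrite /= (ord1 j).
Qed.

Lemma mx2P (R : Type) (A B : 'M[R]_2) :
  A 0 0 = B 0 0 -> A 0 1 = B 0 1 -> A 1 0 = B 1 0 -> A 1 1 = B 1 1 -> A = B.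
Proof.
move=> e00 e01 e10 e11; apply/matrixP => i j.
by elim/forall_ord2: i; elim/forall_ord2: j.
Qed.

(** As a Möbius map this is t |-> 1 / (k + t). *)
Definition cf_letter (k : nat) : 'M[nat]_2 :=
  \matrix_(i, j) (if i == 0 then (j : nat) else if j == 0 then 1%N else k).

Lemma cf_letterE k : [/\ cf_letter k 0 0 = 0%N, cf_letter k 0 1 = 1%N,
  cf_letter k 1 0 = 1%N & cf_letter k 1 1 = k].
Proof. by rewrite !mxE. Qed.

Definition cf_mx (s : seq nat) : 'M[nat]_2 :=
  foldr (fun k A => cf_letter k *m A) 1%:M s.

Lemma cf_mx_cat s t : cf_mx (s ++ t) = cf_mx s *m cf_mx t.
Proof. by elim: s => [|k s IHs] /=; rewrite ?mul1mx // IHs mulmxA. Qed.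

Lemma cf_mx2E k l : [/\ cf_mx [:: k; l] 0 0 = 1%N, cf_mx [:: k; l] 0 1 = l,
  cf_mx [:: k; l] 1 0 = k & cf_mx [:: k; l] 1 1 = (k * l + 1)%N].
Proof.
have [a b c d] := cf_letterE k; have [a' b' c' d'] := cf_letterE l.
rewrite /cf_mx /= mulmx1 !mulmx2E a b c d a' b' c' d'.
by split; rewrite /= -?[GRing.add _ _]/(addn _ _) -?[GRing.mul _ _]/(muln _ _); lia.
Qed.

(* Words of even length with positive letters, as products of pairs [k; l]
   whose matrix is R^k L^l. *)
Inductive paired : seq nat -> Prop :=
| Paired2 k l : (0 < k)%N -> (0 < l)%N -> paired [:: k; l]
| PairedCat s t : paired s -> paired t -> paired (s ++ t).

Lemma mulmx2nE (A B : 'M[nat]_2) i j :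
  (A *m B) i j = (A i 0%R * B 0%R j + A i 1%R * B 1%R j)%N.
Proof. exact: mulmx2E. Qed.

(** Determinant 1 is written as a d = b c + 1, so that it makes sense over [nat]. *)
Lemma det_mulmx2n (A B : 'M[nat]_2) :
  (A 0%R 0%R * A 1%R 1%R = A 0%R 1%R * A 1%R 0%R + 1)%N ->
  (B 0%R 0%R * B 1%R 1%R = B 0%R 1%R * B 1%R 0%R + 1)%N ->
  ((A *m B) 0%R 0%R * (A *m B) 1%R 1%R =
   (A *m B) 0%R 1%R * (A *m B) 1%R 0%R + 1)%N.
Proof.
rewrite !mulmx2nE.
move: (A 0 0) (A 0 1) (A 1 0) (A 1 1) (B 0 0) (B 0 1) (B 1 0) (B 1 1).
move=> a b c d a' b' c' d' dA dB; nia.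
Qed.

Lemma cf_mx_det s : paired s ->
  (cf_mx s 0%R 0%R * cf_mx s 1%R 1%R = cf_mx s 0%R 1%R * cf_mx s 1%R 0%R + 1)%N.
Proof.
elim=> [k l k0 l0|{}s t ps IHs pt IHt]; last by rewrite cf_mx_cat det_mulmx2n.
by have [-> -> -> ->] := cf_mx2E k l; lia.
Qed.

Lemma cf_mx_gt0 s : paired s -> forall i j, (0 < cf_mx s i j)%N.
Proof.
elim=> [k l k0 l0|{}s t ps IHs pt IHt] i j.
  have [a b c d] := cf_mx2E k l.
  by elim/forall_ord2: i; elim/forall_ord2: j; rewrite ?a ?b ?c ?d; lia.
by rewrite cf_mx_cat mulmx2nE addn_gt0 muln_gt0 IHs IHt.
Qed.

Lemma paired_size s : paired s -> (0 < size s)%N.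
Proof. by elim=> // {}s t _ s0 _ t0; rewrite size_cat addn_gt0 s0. Qed.

Lemma paired_sumn s : paired s -> (0 < sumn s)%N.
Proof.
elim=> [k l k0 l0 /=|{}s t _ s0 _ t0]; first by lia.
by rewrite sumn_cat addn_gt0 s0.
Qed.

Section Real.
Variable R : realType.
Implicit Types (t u x y : R) (s : seq nat).

(** Here [t] is the tail that follows the word [s]: convergents are the values at [t = 0], and the
    continued fraction of period [s] is a fixed point. *)
Definition cf_map s t : R := foldr (fun (k : nat) v => (k%:R + v)^-1) t s.

Lemma cf_map_cat s1 s2 t : cf_map (s1 ++ s2) t = cf_map s1 (cf_map s2 t).
Proof. by rewrite /cf_map foldr_cat. Qed.

Lemma cf_map_mx s t : paired s -> 0 <= t ->
  cf_map s t = ((cf_mx s 0 0)%:R * t + (cf_mx s 0 1)%:R) /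
               ((cf_mx s 1 0)%:R * t + (cf_mx s 1 1)%:R).
Proof.
move=> ps; elim: ps t => [k l k0 l0|{}s s' ps IHs ps' IHs'] t t0.
  have [-> -> -> ->] := cf_mx2E k l; rewrite /cf_map /=.
  have k1 : 0 < k%:R :> R by rewrite ltr0n.
  have l1 : 0 < l%:R :> R by rewrite ltr0n.
  by field; repeat split; nra.
rewrite cf_map_cat cf_mx_cat !mulmx2nE.
have gt0 i j : 0 < (cf_mx s i j)%:R :> R by rewrite ltr0n cf_mx_gt0.
have gt0' i j : 0 < (cf_mx s' i j)%:R :> R by rewrite ltr0n cf_mx_gt0.
have d' : 0 < (cf_mx s' 1 0)%:R * t + (cf_mx s' 1 1)%:R.
  by have := gt0' 1 0; have := gt0' 1 1; nra.
have n' : 0 < (cf_mx s' 0 0)%:R * t + (cf_mx s' 0 1)%:R.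
  by have := gt0' 0 0; have := gt0' 0 1; nra.
have q' := divr_gt0 n' d'.
rewrite IHs' // IHs ?ltW // !natrD !natrM.
move: (gt0 1 0) (gt0 1 1) => c0 c1.
field; rewrite andbC; apply/andP; split; first by apply: lt0r_neq0.
apply: lt0r_neq0.
have := addr_gt0 (mulr_gt0 c0 n') (mulr_gt0 c1 d'); congr (0 < _); ring.
Qed.

Lemma cf_map_itv s t : paired s -> 0 <= t -> 0 <= cf_map s t <= 1.
Proof.
move=> ps; elim: ps t => [k l k0 l0|{}s s' ps IHs ps' IHs'] t t0.
  rewrite cf_map_mx //; last by constructor.
  have [-> -> -> ->] := cf_mx2E k l.
  have k1 : 1 <= k%:R :> R by rewrite ler1n.
  have l1 : 1 <= l%:R :> R by rewrite ler1n.
  rewrite divr_ge0 ?ler_pdivrMr ?natrD ?natrM; nra.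
by rewrite cf_map_cat; apply: IHs; case/andP: (IHs' t t0).
Qed.

(** For a Möbius map of determinant 1 the difference of two values is (u - t) / ((c u + d) (c t +
    d)). For a pair of letters both denominators are at least 2, whence the factor 1/4; composition
    preserves both bounds. *)
Lemma cf_map_contract s t u : paired s -> 0 <= t -> t <= u ->
  0 <= cf_map s u - cf_map s t <= (u - t) / 4%:R.
Proof.
move=> ps; elim: ps t u => [k l k0 l0|{}s s' ps IHs ps' IHs'] t u t0 tu.
  have ps : paired [:: k; l] by constructor.
  rewrite !cf_map_mx //; last lra.
  have [-> -> -> ->] := cf_mx2E k l.
  have k1 : 1 <= k%:R :> R by rewrite ler1n.
  have l1 : 1 <= l%:R :> R by rewrite ler1n.
  rewrite natrD natrM.
  move: (k%:R) (l%:R) k1 l1 => {k0 l0 ps} {}k {}l k1 l1.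
  have dt : 2 <= k * t + (k * l + 1) by nra.
  have du : 2 <= k * u + (k * l + 1) by nra.
  rewrite (_ : _ - _ = (u - t) / ((k * u + (k * l + 1)) * (k * t + (k * l + 1)))).
    rewrite divr_ge0 ?subr_ge0 //=; last by nra.
    rewrite ler_wpM2l ?subr_ge0 // lef_pV2 ?posrE; nra.
  field; apply/andP; split; apply: lt0r_neq0; nra.
rewrite !cf_map_cat.
have /andP[a b] := IHs' t u t0 tu.
have /andP[c _] := cf_map_itv ps' t0.
have tu' : cf_map s' t <= cf_map s' u by lra.
by have /andP[-> h] := IHs _ _ c tu'; rewrite /=; lra.
Qed.

Lemma path_mx_row_gt0 x n :
  (0 < path_mx x n 1%R 0%R + path_mx x n 1%R 1%R)%N.
Proof.
elim: n => [|n IHn] /=; first by rewrite !mxE.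
have [l1 l2 l3 l4] := matLE; have [r1 r2 r3 r4] := matRE.
by case: ifP => _; rewrite !mulmx2nE ?l1 ?l2 ?l3 ?l4 ?r1 ?r2 ?r3 ?r4; lia.
Qed.

(** The Möbius map of [matR] is increasing, so each later comparison for y / (1 + y) is equivalent
    to the corresponding one for y, ties included. [path_mx_L] rests on the same remark for
    [matL]. *)
Lemma path_mx_R n y : 0 <= y -> path_mx (y / (1 + y)) n.+1 = matR *m path_mx y n.
Proof.
move=> y0; elim: n => [|n IHn].
  rewrite [LHS]/= !mxE /= add0n !addn0 divr1 !mul1mx mulmx1 ifT //.
  by rewrite ltr_pdivrMr; lra.
rewrite [LHS]/= -/(path_mx _ n.+1) IHn [in RHS]/=.
have [r1 r2 r3 r4] := matRE; rewrite !mulmx2nE r1 r2 r3 r4.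
have := path_mx_row_gt0 y n; move: (path_mx y n) => B b0.
rewrite !mul1n !mul0n !addn0 addnACA.
have b1 : 0 < (B 1 0 + B 1 1)%:R :> R by rewrite ltr0n.
have b2 : 0 <= (B 0 0 + B 0 1)%:R :> R by rewrite ler0n.
rewrite (_ : (_ < _) = (y < (B 0 0 + B 0 1)%:R / (B 1 0 + B 1 1)%:R)).
  by case: ifP => _; rewrite mulmxA.
rewrite (natrD _ (B 0 0 + B 0 1)).
move: (B 0 0 + B 0 1)%:R (B 1 0 + B 1 1)%:R b1 b2 => p q q0 p0.
rewrite ltr_pdivlMr; last by lra.
rewrite mulrAC ltr_pdivrMr; last by lra.
by rewrite ltr_pdivlMr //; apply/idP/idP; lra.
Qed.

Lemma path_mx_L n y : 0 <= y -> path_mx (y + 1) n.+1 = matL *m path_mx y n.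
Proof.
move=> y0; elim: n => [|n IHn].
  rewrite [LHS]/= !mxE /= add0n !addn0 divr1 !mul1mx mulmx1 ifF //.
  by apply/negbTE; rewrite -leNgt; lra.
rewrite [LHS]/= -/(path_mx _ n.+1) IHn [in RHS]/=.
have [r1 r2 r3 r4] := matLE; rewrite !mulmx2nE r1 r2 r3 r4.
have := path_mx_row_gt0 y n; move: (path_mx y n) => B b0.
rewrite !mul1n !mul0n !add0n addnACA.
have b1 : 0 < (B 1 0 + B 1 1)%:R :> R by rewrite ltr0n.
rewrite (_ : (_ < _) = (y < (B 0 0 + B 0 1)%:R / (B 1 0 + B 1 1)%:R)).
  by case: ifP => _; rewrite mulmxA.
rewrite (natrD _ (B 0 0 + B 0 1)).
move: (B 0 0 + B 0 1)%:R (B 1 0 + B 1 1)%:R b1 => p q q0.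
by rewrite !ltr_pdivlMr //; apply/idP/idP; lra.
Qed.

Lemma path_mx_cf_map s t n : paired s -> 0 <= t ->
  path_mx (cf_map s t) (sumn s + n) = cf_mx s *m path_mx t n.
Proof.
move=> ps; elim: ps t n => [k l k0 l0|{}s s' ps IHs ps' IHs'] t n t0; last first.
  rewrite cf_map_cat sumn_cat -addnA IHs; last by case/andP: (cf_map_itv ps' t0).
  by rewrite IHs' // cf_mx_cat mulmxA.
(* The matrices in [HL] and [HR] are the powers L^m and R^m, written entrywise. *)
have HL m : path_mx (m%:R + t) (m + n) =
    (\matrix_(i, j) (if (i == 1) && (j == 0) then 0%N
                     else if i == j then 1%N else m) : 'M[nat]_2) *m path_mx t n.
  elim: m => [|m IHm].
    rewrite add0r add0n; set A := (\matrix_(_, _) _ : 'M[nat]_2).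
    by rewrite (_ : A = 1%:M) ?mul1mx //; apply: mx2P; rewrite !mxE.
  rewrite -natr1 addrAC addSn path_mx_L; last by rewrite addr_ge0.
  rewrite IHm mulmxA; congr (_ *m _).
  have [r1 r2 r3 r4] := matLE.
  by apply: mx2P; rewrite mulmx2nE ?r1 ?r2 ?r3 ?r4 !mxE /=; lia.
have HR m y p : 0 <= y -> path_mx (y / (1 + m%:R * y)) (m + p) =
    (\matrix_(i, j) (if (i == 0) && (j == 1) then 0%N
                     else if i == j then 1%N else m) : 'M[nat]_2) *m path_mx y p.
  move=> y0; elim: m => [|m IHm].
    rewrite mul0r addr0 divr1 add0n; set A := (\matrix_(_, _) _ : 'M[nat]_2).
    by rewrite (_ : A = 1%:M) ?mul1mx //; apply: mx2P; rewrite !mxE.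
  have m0 : 0 <= m%:R :> R by rewrite ler0n.
  have my : 0 <= m%:R * y by rewrite mulr_ge0.
  rewrite (_ : y / _ = (y / (1 + m%:R * y)) / (1 + (y / (1 + m%:R * y)))).
    rewrite addSn path_mx_R; last by rewrite divr_ge0 //; lra.
    rewrite IHm mulmxA; congr (_ *m _).
    have [r1 r2 r3 r4] := matRE.
    by apply: mx2P; rewrite mulmx2nE ?r1 ?r2 ?r3 ?r4 !mxE /=; lia.
  rewrite -natr1; field.
  by apply/andP; split; apply: lt0r_neq0; nra.
have l1 : 0 < l%:R :> R by rewrite ltr0n.
rewrite [sumn _]/= addn0 -addnA
  (_ : cf_map _ _ = (l%:R + t) / (1 + k%:R * (l%:R + t))).
  rewrite HR; last by lra.
  rewrite HL mulmxA; congr (_ *m _).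
  have [r1 r2 r3 r4] := cf_mx2E k l.
  by apply: mx2P; rewrite mulmx2nE ?r1 ?r2 ?r3 ?r4 !mxE /=; lia.
have k1 : 0 < k%:R :> R by rewrite ltr0n.
rewrite /cf_map /=; field.
by apply/andP; split; apply: lt0r_neq0; nra.
Qed.

End Real.

(** * The Lyapunov exponent of a periodic continued fraction *)

Section Spectral.
Variable R : realType.
Implicit Types (t u x y l : R) (s : seq nat).

(* The logarithm of the larger root of z ^ 2 - t z + 1. *)
Definition spec_log t : R := ln ((t + Num.sqrt (t ^+ 2 - 4)) / 2).

Lemma spec_logE t : 2 <= t -> expR (spec_log t) + expR (- spec_log t) = t.
Proof.
move=> t2; have d0 : 0 <= t ^+ 2 - 4 by nra.
have := sqr_sqrtr d0; have := sqrtr_ge0 (t ^+ 2 - 4).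
rewrite expRN /spec_log; move: (Num.sqrt _) => r r0 r2.
have a0 : 0 < (t + r) / 2 by lra.
rewrite lnK ?posrE //; suff -> : ((t + r) / 2)^-1 = t - (t + r) / 2 by lra.
by apply: (mulfI (lt0r_neq0 a0)); rewrite mulfV ?lt0r_neq0 //; nra.
Qed.

Lemma spec_log_ge0 t : 2 <= t -> 0 <= spec_log t.
Proof.
move=> t2; rewrite ln_ge0 // ler_pdivlMr //.
by have := sqrtr_ge0 (t ^+ 2 - 4); lra.
Qed.

(** The function z + 1/z is strictly increasing for z >= 1; if u < l, both exponentials lie in that
    range. *)
Lemma expRDN_le l u : 0 <= u ->
  expR l + expR (- l) <= expR u + expR (- u) -> l <= u.
Proof.
move=> u0; rewrite !expRN => h; rewrite leNgt; apply/negP => ul; move: h.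
have e1 : 1 <= expR u by rewrite -expR0 ler_expR.
have e2 : expR u < expR l by rewrite ltr_expR.
move: (expR u) (expR l) e1 e2 => a b a1 ab; rewrite leNgt => /negP; apply.
rewrite -subr_gt0.
rewrite (_ : _ - _ = (b - a) * (a * b - 1) / (a * b)); last first.
  by field; apply/andP; split; apply: lt0r_neq0; lra.
by rewrite divr_gt0 ?mulr_gt0 //; nra.
Qed.

Lemma expRDN_ge2 l : 2 <= expR l + expR (- l).
Proof.
rewrite expRN; have := expR_gt0 l; move: (expR l) => a a0; rewrite -subr_ge0.
rewrite (_ : _ - _ = (a - 1) ^+ 2 / a); last by field; lra.
by rewrite divr_ge0 ?sqr_ge0 ?ltW.
Qed.

(** Turns a lower bound on a trace into one on the log of the spectral radius; [l] may have either
    sign. *)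
Lemma spec_log_ge l t : expR l + expR (- l) <= t -> l <= spec_log t.
Proof.
move=> h; have t2 : 2 <= t by apply: le_trans (expRDN_ge2 l) h.
by apply: expRDN_le; rewrite ?spec_log_ge0 // spec_logE.
Qed.

Lemma spec_log_eq l : 0 <= l -> spec_log (expR l + expR (- l)) = l.
Proof.
move=> l0; apply/eqP; rewrite eq_le spec_log_ge // andbT.
by apply: expRDN_le => //; rewrite spec_logE // expRDN_ge2.
Qed.

Definition cf_trace s : R := (cf_mx s 0 0)%:R + (cf_mx s 1 1)%:R.

Definition cf_log s := spec_log (cf_trace s).

(** Positive entries and determinant 1 give a d = b c + 1 >= 2, so the matrix is hyperbolic. *)
Lemma cf_trace_gt2 s : paired s -> 2 < cf_trace s.
Proof.
move=> ps; have := cf_mx_gt0 ps; have := cf_mx_det ps => d p.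
have := p 0 0; have := p 0 1; have := p 1 0; have := p 1 1.
rewrite /cf_trace -natrD ltr_nat.
move: (cf_mx s 0 0) (cf_mx s 0 1) (cf_mx s 1 0) (cf_mx s 1 1) d => a b c e.
nia.
Qed.

Lemma cf_mx_detR s : paired s ->
  (cf_mx s 0 0)%:R * (cf_mx s 1 1)%:R =
  (cf_mx s 0 1)%:R * (cf_mx s 1 0)%:R + 1 :> R.
Proof. by move=> ps; rewrite -!natrM cf_mx_det // natrD. Qed.

(* [rho] is the Perron eigenvalue of cf_mx s; ((rho - d) / c, 1) spans its right
   eigenline and (c, rho - a) its left eigenline. *)
Lemma cf_mx_perron s : paired s ->
  let rho := expR (cf_log s) in
  [/\ rho ^+ 2 - cf_trace s * rho + 1 = 0,
      0 < rho - (cf_mx s 0 0)%:R & 0 < rho - (cf_mx s 1 1)%:R].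
Proof.
move=> ps rho; have t2 := cf_trace_gt2 ps.
have tE : rho + rho^-1 = cf_trace s by rewrite -expRN spec_logE // ltW.
have r0 : 0 < rho by exact: expR_gt0.
have r1 : 1 <= rho by rewrite -expR0 ler_expR spec_log_ge0 // ltW.
have rE : rho ^+ 2 - cf_trace s * rho + 1 = 0.
  by rewrite -tE; field; lra.
have d := cf_mx_detR ps.
have b0 : 0 < (cf_mx s 0 1)%:R :> R by rewrite ltr0n cf_mx_gt0.
have c0 : 0 < (cf_mx s 1 0)%:R :> R by rewrite ltr0n cf_mx_gt0.
have rV : rho^-1 <= 1 by rewrite invf_le1.
move: tE rE; rewrite /cf_trace => tE rE.
(* By the characteristic equation this product equals b c, and the sum of its factors is rho - 1/rho
   >= 0; hence both factors are positive. *)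
have p : 0 < (rho - (cf_mx s 0 0)%:R) * (rho - (cf_mx s 1 1)%:R).
  by have := mulr_gt0 b0 c0; nra.
have q : 0 <= (rho - (cf_mx s 0 0)%:R) + (rho - (cf_mx s 1 1)%:R) by lra.
by split=> //; rewrite ltNge; apply/negP => h; nra.
Qed.

Lemma periodic_cfE s x : paired s -> 0 <= x <= 1 -> cf_map s x = x ->
  periodic_cf R s = x.
Proof.
move=> ps /andP[x0 x1] fx; rewrite /periodic_cf /cf.
set v := fun i => nth 0%N s (i %% size s).
have s0 := paired_size ps.
have vS n : cf_conv R (mkseq v (size s + n)) = cf_map s (cf_conv R (mkseq v n)).
  rewrite -cf_map_cat; congr (foldr _ _ _); rewrite /mkseq iotaD map_cat.
  congr (_ ++ _).
    rewrite -[RHS](mkseq_nth 0%N); apply/eq_in_map => i.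
    by rewrite mem_iota add0n => /andP[_ h]; rewrite /v modn_small.
  rewrite addnC iotaDl -map_comp; apply: eq_map => i /=.
  by rewrite /v modnDl.
have c0 n : 0 <= cf_conv R (mkseq v n).
  rewrite /cf_conv; elim: (mkseq v n) => //= k r IHr.
  by rewrite invr_ge0 addr_ge0.
have dist t : 0 <= t -> `|cf_map s t - x| <= `|t - x| / 4%:R.
  move=> t0; rewrite -{1}fx; case: (leP t x) => tx.
    have /andP[a b] := cf_map_contract ps t0 tx.
    by rewrite distrC ger0_norm // distrC ger0_norm //; lra.
  have /andP[a b] := cf_map_contract ps x0 (ltW tx).
  by rewrite ger0_norm // ger0_norm //; lra.
(* A crude bound for the convergents within the first period; each further period divides the
   distance to [x] by 4. *)
have [D D0 Dm] : exists2 D : R, 0 <= D & forall i, (i < size s)%N ->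
    `|cf_conv R (mkseq v i) - x| <= D.
  exists (\sum_(i < size s) `|cf_conv R (mkseq v i) - x|).
    by apply: sumr_ge0.
  move=> i ilt; rewrite (bigD1 (Ordinal ilt)) //= lerDl.
  by apply: sumr_ge0.
have bnd j i : (i < size s)%N ->
    `|cf_conv R (mkseq v (j * size s + i)) - x| <= D * (4%:R^-1) ^+ j.
  move=> ilt; elim: j => [|j IHj]; first by rewrite mul0n add0n mulr1 Dm.
  rewrite mulSn -addnA vS; apply: le_trans (dist _ (c0 _)) _.
  by rewrite exprSr mulrA ler_wpM2r.
apply/cvg_lim; first exact: norm_hausdorff.
apply/cvgrPdist_le => e e0.
have : (fun j => D * (4%:R^-1) ^+ j) @ \oo --> (0 : R).
  rewrite -[X in _ --> X](mulr0 D); apply: cvgMr; apply: cvg_expr.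
  by rewrite ger0_norm // invf_lt1 // ltr1n.
move/cvgrPdist_le => /(_ e e0) [j0 _ hj].
exists (j0 * size s)%N => //= n nj.
rewrite distrC {1}(divn_eq n (size s)).
apply: le_trans (bnd _ _ _) _; first by rewrite ltn_mod.
have := hj (n %/ size s)%N; rewrite /= sub0r normrN ger0_norm; last first.
  by rewrite mulr_ge0 // exprn_ge0.
by apply; rewrite leq_divRL.
Qed.

Lemma periodic_cf_fix s : paired s ->
  cf_map s (periodic_cf R s) = periodic_cf R s /\ 0 <= periodic_cf R s <= 1.
Proof.
move=> ps; have [rE ra rd] := cf_mx_perron ps; set rho := expR _ in rE ra rd.
(* Since (x, 1) is a right eigenvector, the denominator c x + d of the Möbius map at [x] is
   [rho]. *)
pose x := (rho - (cf_mx s 1 1)%:R) / (cf_mx s 1 0)%:R.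
have c0 : 0 < (cf_mx s 1 0)%:R :> R by rewrite ltr0n cf_mx_gt0.
have x0 : 0 <= x by rewrite divr_ge0 // ltW.
have d := cf_mx_detR ps.
have fx : cf_map s x = x.
  rewrite cf_map_mx // (_ : (cf_mx s 1 0)%:R * x + (cf_mx s 1 1)%:R = rho).
    have r0 : 0 < rho by exact: expR_gt0.
    have xc : x * (cf_mx s 1 0)%:R = rho - (cf_mx s 1 1)%:R.
      by rewrite divfK ?lt0r_neq0.
    apply: (canLR (mulfK (lt0r_neq0 r0))); apply: (mulIf (lt0r_neq0 c0)).
    rewrite mulrDl -mulrA xc [RHS]mulrAC xc.
    by move: rE; rewrite /cf_trace; nra.
  by rewrite /x; field; lra.
have xi : 0 <= x <= 1 by rewrite -fx; apply: cf_map_itv.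
by rewrite (periodic_cfE ps xi fx).
Qed.

Lemma max_entry_ge (A : 'M[nat]_2) i j : (A i j <= max_entry A)%N.
Proof.
apply: leq_trans (leq_bigmax i).
by apply: (leq_trans _ (leq_bigmax j)).
Qed.

Lemma max_entry_le_sum (A : 'M[nat]_2) :
  (max_entry A <= (A 0%R 0%R + A 0%R 1%R) + (A 1%R 0%R + A 1%R 1%R))%N.
Proof.
apply/bigmax_leqP => i _; apply/bigmax_leqP => j _.
by elim/forall_ord2: i; elim/forall_ord2: j; lia.
Qed.

(** A bounded deviation from n theta vanishes after division by n, so the limsup is a limit. *)
Lemma Lyapunov_cvg x theta K : (forall n, (0 < n)%N ->
    `|ln (max_entry (path_mx x n))%:R - n%:R * theta| <= K) ->
  Lyapunov x = theta.
Proof.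
move=> hK; rewrite /Lyapunov.
suff h : (fun n => ln (max_entry (path_mx x n))%:R / n%:R) @ \oo --> (theta : R^o).
  by have [_ ->] := cvg_limn_inf_sup h.
apply/cvgrPdist_le => e e0; near=> n.
have n0 : (0 < n)%N by near: n; exists 1%N.
have n0' : 0 < n%:R :> R by rewrite ltr0n.
rewrite distrC (_ : _ - _ =
  (ln (max_entry (path_mx x n))%:R - n%:R * theta) / n%:R); last by field; lra.
rewrite normrM normfV (ger0_norm (ltW n0')) ler_pdivrMr //.
apply: le_trans (hK n n0) _; rewrite -ler_pdivrMl // mulrC.
by near: n; exact: nbhs_infty_ger.
Unshelve. all: by end_near.
Qed.

Lemma Lyapunov_periodic s : paired s ->
  Lyapunov (periodic_cf R s) = cf_log s / (sumn s)%:R.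
Proof.
move=> ps; have [fx /andP[x0 x1]] := periodic_cf_fix ps.
set x := periodic_cf R s in fx x0 x1 *.
have [rE ra rd] := cf_mx_perron ps; set rho := expR _ in rE ra rd.
have r0 : 0 < rho by exact: expR_gt0.
have c0 : 0 < (cf_mx s 1 0)%:R :> R by rewrite ltr0n cf_mx_gt0.
have d := cf_mx_detR ps.
have N0 : 0 < (sumn s)%:R :> R by rewrite ltr0n paired_sumn.
pose theta := cf_log s / (sumn s)%:R.
pose A n := path_mx x n.
set e0 := (cf_mx s 1 0)%:R in c0 d *; set e1 := rho - _ in ra.
(* The row (e0, e1) is the left Perron eigenvector and S n = (e0, e1) A_n (1, 1)^T. One period
   multiplies S by exactly [rho], and S n is comparable with the largest entry of A_n up to
   constants. So ln (S n) - n theta is periodic in n, hence bounded. *)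
pose S n := e0 * ((A n 0 0)%:R + (A n 0 1)%:R) + e1 * ((A n 1 0)%:R + (A n 1 1)%:R).
have Sper n : S (sumn s + n)%N = rho * S n.
  rewrite /S /A -{1 2 3 4}fx path_mx_cf_map // !mulmx2nE !natrD !natrM -/e0.
  have h1 : e0 * (cf_mx s 0 0)%:R + e1 * e0 = rho * e0 by rewrite /e1; ring.
  have h2 : e0 * (cf_mx s 0 1)%:R + e1 * (cf_mx s 1 1)%:R = rho * e1.
    by move: rE; rewrite /cf_trace /e1; nra.
  transitivity ((e0 * (cf_mx s 0 0)%:R + e1 * e0) * ((A n 0 0)%:R + (A n 0 1)%:R) +
    (e0 * (cf_mx s 0 1)%:R + e1 * (cf_mx s 1 1)%:R) * ((A n 1 0)%:R + (A n 1 1)%:R)).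
    by rewrite /A; ring.
  by rewrite h1 h2 /A; ring.
have Sgt0 n : e1 <= S n.
  have := path_mx_row_gt0 x n; rewrite -/(A n) -(ler1n R) natrD => h.
  have h0 : 0 <= e0 * ((A n 0 0)%:R + (A n 0 1)%:R).
    by rewrite mulr_ge0 ?addr_ge0 // ltW.
  by rewrite /S; nra.
pose h n := ln (S n) - n%:R * theta.
have hper n : h (sumn s + n)%N = h n.
  rewrite /h Sper lnM ?posrE //; last exact: lt_le_trans (Sgt0 n).
  by rewrite expRK natrD /theta; field; lra.
pose H := \sum_(i < sumn s) `|h i|.
have hH n : `|h n| <= H.
  rewrite (divn_eq n (sumn s)); elim: (n %/ sumn s)%N => [|j IHj].
    have lt : (n %% sumn s < sumn s)%N by rewrite ltn_mod paired_sumn.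
    rewrite mul0n add0n /H (bigD1 (Ordinal lt)) //= lerDl.
    by apply: sumr_ge0.
  by rewrite mulSn -addnA hper.
pose W n : R := (max_entry (A n))%:R.
pose m := Num.min e0 e1; pose M := 2 * (e0 + e1).
have m0 : 0 < m by rewrite lt_min c0 ra.
have SW n : S n <= M * W n.
  have hW i j : (A n i j)%:R <= W n by rewrite ler_nat max_entry_ge.
  have := hW 0 0; have := hW 0 1; have := hW 1 0; have := hW 1 1.
  by rewrite /S /M; nra.
have M0 : 0 < M by rewrite /M; lra.
have W0 n : 0 < W n.
  rewrite -(pmulr_rgt0 _ M0); apply: lt_le_trans (SW n).
  exact: lt_le_trans (Sgt0 n).
have WS n : m * W n <= S n.
  have hW : W n <= ((A n 0 0)%:R + (A n 0 1)%:R) + ((A n 1 0)%:R + (A n 1 1)%:R).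
    by rewrite -!natrD ler_nat max_entry_le_sum.
  have p0 : 0 <= (A n 0 0)%:R + (A n 0 1)%:R :> R by rewrite addr_ge0.
  have q0 : 0 <= (A n 1 0)%:R + (A n 1 1)%:R :> R by rewrite addr_ge0.
  have me0 : m <= e0 by rewrite ge_min lexx.
  have me1 : m <= e1 by rewrite ge_min lexx orbT.
  by rewrite /S; nra.
apply: (@Lyapunov_cvg x theta (H + `|ln m| + `|ln M|)) => n _.
have S0 := lt_le_trans ra (Sgt0 n).
have l1 : ln (S n) <= ln M + ln (W n).
  by rewrite -lnM ?posrE // ler_ln ?posrE // mulr_gt0.
have l2 : ln m + ln (W n) <= ln (S n).
  by rewrite -lnM ?posrE // ler_ln ?posrE // mulr_gt0.
have := hH n; rewrite /h -/(A n) -/(W n).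
have := ler_norm (ln M); have := ler_norm (- ln m); rewrite normrN.
rewrite !ler_norml => nm nM /andP[hl hu].
have := normr_ge0 (ln m); have := normr_ge0 (ln M).
have := ler_norm (ln m); have := ler_norm (- ln M); rewrite normrN => *.
by apply/andP; split; lra.
Qed.

End Spectral.

(** * The Farey tree *)

Definition farey (p q p' q' : nat) :=
  [/\ (p' * q = p * q' + 1)%N, (0 < q)%N, (0 < q')%N & (2 * p' <= q')%N].

Lemma farey_left p q p' q' : farey p q p' q' -> farey p q (p + p') (q + q').
Proof. by case=> *; split; nia. Qed.

Lemma farey_right p q p' q' : farey p q p' q' -> farey (p + p') (q + q') p' q'.
Proof. by case=> *; split; nia. Qed.

Lemma farey_coprime p q p' q' : farey p q p' q' -> coprime p q /\ coprime p' q'.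
Proof.
case=> d _ _ _; rewrite /coprime -!dvdn1; split.
  rewrite -(@dvdn_addr (p * q')); first by rewrite -d dvdn_mull // dvdn_gcdr.
  by rewrite dvdn_mulr // dvdn_gcdl.
rewrite -(@dvdn_addr (p * q')); first by rewrite -d dvdn_mulr // dvdn_gcdl.
by rewrite dvdn_mull // dvdn_gcdr.
Qed.

Lemma coprime_frac_inj x y p q : coprime x y -> coprime p q ->
  (0 < y)%N -> (x * q = p * y)%N -> x = p /\ y = q.
Proof.
move=> cxy cpq y0 e.
have yq : (y %| q)%N by rewrite -(@Gauss_dvdr _ x) 1?coprime_sym // e dvdn_mull.
have qy : (q %| y)%N by rewrite -(@Gauss_dvdr _ p) 1?coprime_sym // -e dvdn_mull.
have yE : y = q by apply/eqP; rewrite eqn_dvd yq.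
by split=> //; apply/eqP; rewrite -(eqn_pmul2r y0) {1}yE e.
Qed.

(** Descent in the Farey tree: a fraction strictly inside an interval has denominator at least q +
    q', which grows at each step, so x/y is eventually the mediant. The conclusion is then carried
    back outwards. *)
Lemma farey_rec (x y : nat) (Q : nat -> nat -> nat -> nat -> Prop) :
  coprime x y -> (0 < y)%N ->
  (forall p q p' q', farey p q p' q' -> x = (p + p')%N -> y = (q + q')%N ->
     Q p q p' q') ->
  (forall p q p' q', farey p q p' q' ->
     (p * y < x * q)%N -> (x * (q + q') < (p + p') * y)%N ->
     Q p q (p + p')%N (q + q')%N -> Q p q p' q') ->
  (forall p q p' q', farey p q p' q' ->
     ((p + p') * y < x * (q + q'))%N -> (x * q' < p' * y)%N ->
     Q (p + p')%N (q + q')%N p' q' -> Q p q p' q') ->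
  forall p q p' q', farey p q p' q' -> (p * y < x * q)%N -> (x * q' < p' * y)%N ->
    Q p q p' q'.
Proof.
move=> cxy y0 Qm Ql Qr p q p' q'.
have [n] := ubnP (y - (q + q'))%N; elim: n p q p' q' => // n IHn p q p' q' yn F lx gx.
have [d q0 q'0 le2] := F; have ley := farey_between d lx gx.
have [cm _] := farey_coprime (farey_right F).
case: (ltngtP (x * (q + q')) ((p + p') * y)) => [h|h|h]; last first.
- have [xE yE] := coprime_frac_inj cxy cm y0 h; exact: Qm.
- have F' := farey_right F; have [d' _ _ _] := F'.
  have := farey_between d' h gx => h'.
  by apply: Qr => //; apply: IHn => //; lia.
- have F' := farey_left F; have [d' _ _ _] := F'.
  have := farey_between d' lx h => h'.
  by apply: Ql => //; apply: IHn => //; lia.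
Qed.

Lemma farey_case p q p' q' x y : farey p q p' q' -> coprime x y -> (0 < y)%N ->
  (p * y <= x * q)%N -> (x * q' <= p' * y)%N ->
  [\/ x = p /\ y = q, x = p' /\ y = q' | (p * y < x * q)%N /\ (x * q' < p' * y)%N].
Proof.
move=> F cxy y0; have [c c'] := farey_coprime F.
case: ltngtP => // [lx _|e _ _]; last by constructor 1; apply: coprime_frac_inj.
case: ltngtP => // [gx _|e _]; last by constructor 2; apply: coprime_frac_inj.
by constructor 3.
Qed.

Lemma farey_ind (P : nat -> nat -> Prop) p q p' q' :
  (forall b d b' d', farey b d b' d' -> P b d -> P b' d' ->
     P (b + b')%N (d + d')%N) ->
  farey p q p' q' -> P p q -> P p' q' ->
  forall x y, coprime x y -> (0 < y)%N -> (p * y <= x * q)%N ->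
    (x * q' <= p' * y)%N -> P x y.
Proof.
move=> Pm F Pp Pp' x y cxy y0 lx gx.
case: (farey_case F cxy y0 lx gx) => [[-> ->]|[-> ->]|[{}lx {}gx]] //.
move: Pp Pp'; apply: (@farey_rec x y (fun p q p' q' => P p q -> P p' q' -> P x y))
  F lx gx => // {p q p' q'} p q p' q' F.
- by move=> -> -> Pp Pp'; apply: Pm.
- by move=> _ _ IH Pp Pp'; apply: IH => //; apply: Pm.
- by move=> _ _ IH Pp Pp'; apply: IH => //; apply: Pm.
Qed.

(** Monotonicity need only be checked at mediants, and there the ends may be assumed ordered
    already. A general preorder [le] also covers decreasing functions. *)
Lemma farey_homo (T : Type) (f : nat -> nat -> T) (le : T -> T -> Prop) :
  (forall u, le u u) -> (forall u v w, le u v -> le v w -> le u w) ->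
  (forall b d b' d', farey b d b' d' -> le (f b d) (f b' d') ->
     le (f b d) (f (b + b')%N (d + d')%N) /\
     le (f (b + b')%N (d + d')%N) (f b' d')) ->
  forall p q p' q', farey p q p' q' -> le (f p q) (f p' q') ->
  forall x y x' y', coprime x y -> coprime x' y' -> (0 < y)%N -> (0 < y')%N ->
    (p * y <= x * q)%N -> (x * y' <= x' * y)%N -> (x' * q' <= p' * y')%N ->
    le (f x y) (f x' y').
Proof.
move=> refl trans step.
have between p q p' q' : farey p q p' q' -> le (f p q) (f p' q') ->
    forall x y, coprime x y -> (0 < y)%N -> (p * y <= x * q)%N ->
    (x * q' <= p' * y)%N -> le (f p q) (f x y) /\ le (f x y) (f p' q').
  move=> F le0 x y cxy y0 lx gx.
  case: (farey_case F cxy y0 lx gx) => [[-> ->]|[-> ->]|[{}lx {}gx]] //.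
  move: le0; apply: (@farey_rec x y (fun p q p' q' => le (f p q) (f p' q') ->
    le (f p q) (f x y) /\ le (f x y) (f p' q'))) F lx gx => // {p q p' q'} p q p' q' F.
  - by move=> -> -> /(step _ _ _ _ F).
  - move=> _ _ IH /(step _ _ _ _ F) [l1 l2]; have [l3 l4] := IH l1.
    by split=> //; apply: trans l2.
  - move=> _ _ IH /(step _ _ _ _ F) [l1 l2]; have [l3 l4] := IH l2.
    by split=> //; apply: trans l3.
move=> p q p' q' F le0 x y x' y' cxy cxy' y0 y'0 lx lxx' gx'.
have [[d q0 q'0 le2] [c c']] := (F, farey_coprime F).
have lx' : (p * y' <= x' * q)%N by rewrite -(leq_pmul2l y0); nia.
have gx : (x * q' <= p' * y)%N by rewrite -(leq_pmul2l y'0); nia.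
case: (farey_case F cxy' y'0 lx' gx') => [[e1 e2]|[-> ->]|[{}lx' {}gx']].
- rewrite e1 e2 in lxx' *.
  have h : (x * q = p * y)%N by lia.
  by have [-> ->] := coprime_frac_inj cxy c y0 h.
- by have [] := between _ _ _ _ F le0 x y cxy y0 lx gx.
move: le0 lx; apply: (@farey_rec x' y' (fun p q p' q' => le (f p q) (f p' q') ->
    (p * y <= x * q)%N -> le (f x y) (f x' y'))) F lx' gx' => //
  {q0 q'0 le2 d c c' gx} {}p {}q {}p' {}q' F.
- move=> e1 e2 /(step _ _ _ _ F) [l1 l2] lx.
  rewrite e1 e2 in lxx' *.
  by have [] := between _ _ _ _ (farey_left F) l1 x y cxy y0 lx lxx'.
- by move=> _ _ IH /(step _ _ _ _ F) [l1 l2] lx; apply: IH.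
- move=> h gx IH /(step _ _ _ _ F) [l1 l2] lx.
  case: (leqP ((p + p') * y) (x * (q + q'))) => h'; first exact: IH.
  (* The mediant separates x/y from x'/y', so the two values are compared through it. *)
  have [_ l3] := between _ _ _ _ (farey_left F) l1 x y cxy y0 lx (ltnW h').
  apply: trans l3 _.
  by have [] := between _ _ _ _ (farey_right F) l2 x' y' cxy' y'0 (ltnW h) (ltnW gx).
Qed.

(** * Trace identities and sign patterns in SL2 *)

Section Mx2.
Variable R : comPzRingType.
Implicit Types A B P Q : 'M[R]_2.

Definition tr2 A := A 0 0 + A 1 1.
Definition det2 A := A 0 0 * A 1 1 - A 0 1 * A 1 0.

Definition mx2 (a b c d : R) : 'M[R]_2 :=
  \matrix_(i, j) (if i == 0 then if j == 0 then a else b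
                  else if j == 0 then c else d).

Lemma mx2E a b c d : [/\ mx2 a b c d 0 0 = a, mx2 a b c d 0 1 = b,
  mx2 a b c d 1 0 = c & mx2 a b c d 1 1 = d].
Proof. by rewrite !mxE. Qed.

Definition adj2 A := mx2 (A 1 1) (- A 0 1) (- A 1 0) (A 0 0).

Lemma mx2_1E : [/\ (1%:M : 'M[R]_2) 0 0 = 1, (1%:M : 'M[R]_2) 0 1 = 0,
  (1%:M : 'M[R]_2) 1 0 = 0 & (1%:M : 'M[R]_2) 1 1 = 1].
Proof. by rewrite !mxE. Qed.

Lemma det2M A B : det2 (A *m B) = det2 A * det2 B.
Proof. by rewrite /det2 !mulmx2E; ring. Qed.

Lemma det2_1 : det2 1%:M = 1.
Proof. by rewrite /det2; have [-> -> -> ->] := mx2_1E; ring. Qed.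

Lemma tr2C A B : tr2 (A *m B) = tr2 (B *m A).
Proof. by rewrite /tr2 !mulmx2E; ring. Qed.

Lemma mul_adj2mx A : det2 A = 1 -> adj2 A *m A = 1%:M.
Proof.
rewrite /det2 => d; have [a1 b1 c1 d1] := mx2_1E.
have [a2 b2 c2 d2] := mx2E (A 1 1) (- A 0 1) (- A 1 0) (A 0 0).
by apply: mx2P; rewrite mulmx2E ?a1 ?b1 ?c1 ?d1 ?a2 ?b2 ?c2 ?d2 -?d; ring.
Qed.

Lemma mulmx_adj2 A : det2 A = 1 -> A *m adj2 A = 1%:M.
Proof.
rewrite /det2 => d; have [a1 b1 c1 d1] := mx2_1E.
have [a2 b2 c2 d2] := mx2E (A 1 1) (- A 0 1) (- A 1 0) (A 0 0).
by apply: mx2P; rewrite mulmx2E ?a1 ?b1 ?c1 ?d1 ?a2 ?b2 ?c2 ?d2 -?d; ring.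
Qed.

Definition mxconj P Q A := P *m A *m Q.

Lemma mxconjM P Q A B : Q *m P = 1%:M ->
  mxconj P Q (A *m B) = mxconj P Q A *m mxconj P Q B.
Proof. by move=> QP; rewrite /mxconj !mulmxA -(mulmxA _ Q P) QP mulmx1. Qed.

Lemma tr2_conj P Q A : Q *m P = 1%:M -> tr2 (mxconj P Q A) = tr2 A.
Proof. by move=> QP; rewrite /mxconj tr2C mulmxA QP mul1mx. Qed.

Lemma det2_conj P Q A : Q *m P = 1%:M -> det2 (mxconj P Q A) = det2 A.
Proof.
move=> QP; have := congr1 det2 QP.
by rewrite /mxconj !det2M det2_1 => e; rewrite -[RHS]mulr1 -e; ring.
Qed.

(* This is tr [A, B] + 2 when det A = det B = 1. *)
Definition fricke A B :=
  tr2 A ^+ 2 + tr2 B ^+ 2 + tr2 (B *m A) ^+ 2 - tr2 A * tr2 B * tr2 (B *m A).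

(** A Vieta move: by Cayley-Hamilton, tr (B A A) = tr (B A) tr A - tr B, the other root of the
    quadratic equation that [fricke] defines for tr B. *)
Lemma fricke_mull A B : det2 A = 1 -> fricke A (B *m A) = fricke A B.
Proof.
move=> d; rewrite /fricke (_ : tr2 (B *m A *m A) = tr2 (B *m A) * tr2 A - tr2 B).
  by ring.
rewrite -[tr2 B]mulr1 -d /tr2 /det2 !mulmx2E; ring.
Qed.

Lemma fricke_mulr A B : det2 B = 1 -> fricke (B *m A) B = fricke A B.
Proof.
move=> d; rewrite /fricke (_ : tr2 (B *m (B *m A)) = tr2 (B *m A) * tr2 B - tr2 A).
  by ring.
rewrite -[tr2 A]mulr1 -d /tr2 /det2 !mulmx2E; ring.
Qed.

End Mx2.

(** * Multiplicative sign patterns in an eigenbasis *)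

Section Good.
Variable R : realType.
Implicit Types (A B C X Y P Q : 'M[R]_2) (e l m x : R).

(* Used with e = 1 to the left of a chosen fraction and e = -1 to its right; this
   is multiplicative, and l is a lower bound for the log of the spectral radius. *)
Definition good e A l := [/\ expR l <= A 0 0, expR (- l) <= A 1 1,
  0 <= e * A 0 1 & 0 <= e * A 1 0].

Lemma good_mul e A B l m : e * e = 1 -> good e A l -> good e B m ->
  good e (A *m B) (l + m).
Proof.
move=> ee [a1 a2 a3 a4] [b1 b2 b3 b4].
have pl := expR_gt0 l; have pm := expR_gt0 m.
have pl' := expR_gt0 (- l); have pm' := expR_gt0 (- m).
have a00 : 0 <= A 0 0 by lra.
have a11 : 0 <= A 1 1 by lra.
have b00 : 0 <= B 0 0 by lra.
have b11 : 0 <= B 1 1 by lra.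
have x1 : 0 <= A 0 1 * B 1 0.
  by have := mulr_ge0 a3 b4; rewrite mulrACA ee mul1r.
have x2 : 0 <= A 1 0 * B 0 1.
  by have := mulr_ge0 a4 b3; rewrite mulrACA ee mul1r.
have y1 : expR l * expR m <= A 0 0 * B 0 0 by apply: ler_pM => //; exact: ltW.
have y2 : expR (- l) * expR (- m) <= A 1 1 * B 1 1 by apply: ler_pM => //; exact: ltW.
rewrite /good opprD !expRD !mulmx2E; split; try lra.
- by have := mulr_ge0 a00 b3; have := mulr_ge0 a3 b11; lra.
- by have := mulr_ge0 b00 a4; have := mulr_ge0 b4 a11; lra.
Qed.

Lemma good_adj e A l : good e A l -> good (- e) (adj2 A) (- l).
Proof.
case=> a1 a2 a3 a4; rewrite /good opprK /adj2.
by have [-> -> -> ->] := mx2E (A 1 1) (- A 0 1) (- A 1 0) (A 0 0); rewrite !mulrNN.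
Qed.

(** From X = Y^-1 (Y X), where inversion flips [e] and negates the bound: one parent is recovered
    from the mediant and the other parent. *)
Lemma good_divl e X Y l m : e * e = 1 -> det2 Y = 1 ->
  good e (Y *m X) (m + l) -> good (- e) Y m -> good e X l.
Proof.
move=> ee d gYX /good_adj; rewrite opprK => gY.
have := good_mul ee gY gYX.
by rewrite addKr mulmxA mul_adj2mx // mul1mx.
Qed.

Lemma good_divr e X Y l m : e * e = 1 -> det2 X = 1 ->
  good e (Y *m X) (m + l) -> good (- e) X l -> good e Y m.
Proof.
move=> ee d gYX /good_adj; rewrite opprK => gX.
have := good_mul ee gYX gX.
by rewrite addrK -mulmxA mulmx_adj2 // mulmx1.
Qed.

Lemma good_trace e A l : good e A l -> l <= spec_log (tr2 A).
Proof. by case=> a1 a2 _ _; apply: spec_log_ge; rewrite /tr2; lra. Qed.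

Lemma eigenbasis C : det2 C = 1 -> 2 < tr2 C -> 0 < C 1 0 ->
  let m := expR (spec_log (tr2 C)) in
  exists P Q, [/\ Q *m P = 1%:M, P *m Q = 1%:M & mxconj P Q C = mx2 m 0 0 m^-1].
Proof.
move=> d t2 c0 m; have m0 : 0 < m by exact: expR_gt0.
have mE : m + m^-1 = tr2 C by rewrite -expRN spec_logE // ltW.
have : m ^+ 2 - tr2 C * m + 1 = 0 by rewrite -mE; field; lra.
have : m^-1 != m.
  apply/eqP => e; rewrite e in mE; have := mulfV (lt0r_neq0 m0); rewrite e.
  by nra.
have : m * m^-1 = 1 by rewrite mulfV ?lt0r_neq0.
move: d mE c0; rewrite /det2 /tr2; move: m m^-1 {m0 t2} => m n.
have [a aE] : {a | C 0 0 = a} by exists (C 0 0).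
have [b bE] : {b | C 0 1 = b} by exists (C 0 1).
have [c cE] : {c | C 1 0 = c} by exists (C 1 0).
have [d dE] : {d | C 1 1 = d} by exists (C 1 1).
rewrite aE bE cE dE => det mE c0 mn nm mP.
have nP : n ^+ 2 - (a + d) * n + 1 = 0 by rewrite -mE -mn; ring.
(* The rows of [P] are left eigenvectors of [C] for [m] and its inverse [n]; [Q] is the inverse of
   [P]. *)
pose P := mx2 c (m - a) c (n - a).
have [p1 p2 p3 p4] := mx2E c (m - a) c (n - a).
pose Q := mx2 ((n - a) / (c * (n - m))) (- (m - a) / (c * (n - m)))
              (- (n - m)^-1) (n - m)^-1.
have [q1 q2 q3 q4] := mx2E ((n - a) / (c * (n - m))) (- (m - a) / (c * (n - m)))
              (- (n - m)^-1) (n - m)^-1.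
have [i1 i2 i3 i4] := mx2_1E R.
have [d1 d2 d3 d4] := mx2E m 0 0 n.
have nm1 : n - m != 0 by rewrite subr_eq0.
have cn0 : c != 0 by exact: lt0r_neq0.
have QP : Q *m P = 1%:M.
  apply: mx2P; rewrite mulmx2E ?i1 ?i2 ?i3 ?i4 ?p1 ?p2 ?p3 ?p4 ?q1 ?q2 ?q3 ?q4;
    by field; rewrite ?nm1 ?cn0.
have PQ : P *m Q = 1%:M.
  apply: mx2P; rewrite mulmx2E ?i1 ?i2 ?i3 ?i4 ?p1 ?p2 ?p3 ?p4 ?q1 ?q2 ?q3 ?q4;
    by field; rewrite ?nm1 ?cn0.
exists P, Q; split=> //; rewrite /mxconj.
suff -> : P *m C = mx2 m 0 0 n *m P by rewrite -mulmxA PQ mulmx1.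
apply: mx2P; rewrite !mulmx2E ?aE ?bE ?cE ?dE ?d1 ?d2 ?d3 ?d4 ?p1 ?p2 ?p3 ?p4; lra.
Qed.

(** Both signs [e] are allowed, so the matrix of the chosen fraction serves on its left and on its
    right. *)
Lemma good_diag e l : good e (mx2 (expR l) 0 0 (expR l)^-1) l.
Proof.
rewrite /good; have [-> -> -> ->] := mx2E (expR l) 0 0 (expR l)^-1.
by rewrite !mulr0 -expRN.
Qed.

Lemma good_basis C X : det2 C = 1 -> 2 < tr2 C -> 0 < C 1 0 ->
  det2 X = 1 -> 0 < tr2 X -> fricke X C <= 4 ->
  exists P Q l, [/\ Q *m P = 1%:M,
    mxconj P Q C = mx2 (expR (spec_log (tr2 C))) 0 0 (expR (spec_log (tr2 C)))^-1
    & good 1 (mxconj P Q X) l].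
Proof.
move=> dC tC c0 dX tX K.
have [P [Q [QP PQ CE]]] := eigenbasis dC tC c0.
set m := expR _ in CE *; have m0 : 0 < m by exact: expR_gt0.
have mE : m + m^-1 = tr2 C by rewrite -expRN spec_logE // ltW.
move: CE mE K tC; move: (mulfV (lt0r_neq0 m0)); move: m^-1 => n mn CE mE K tC.
have [d1 d2 d3 d4] := mx2E m 0 0 n.
have tCX : tr2 (C *m X) = m * mxconj P Q X 0 0 + n * mxconj P Q X 1 1.
  by rewrite -(tr2_conj _ QP) mxconjM // CE /tr2 !mulmx2E d1 d2 d3 d4; ring.
move: K tX dX; rewrite /fricke tCX -(tr2_conj X QP) -(det2_conj X QP) /tr2 /det2.
set X' := mxconj P Q X; rewrite -/(tr2 C) -mE.
have [al alE] : {al | X' 0 0 = al} by exists (X' 0 0).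
have [be beE] : {be | X' 1 1 = be} by exists (X' 1 1).
have [s sE] : {s | X' 0 1 = s} by exists (X' 0 1).
have [t tE] : {t | X' 1 0 = t} by exists (X' 1 0).
rewrite alE beE sE tE => K tX dX.
(* With T = (m + n)^2 and m n = 1, the bound [K] reads T + al be (4 - T) <= 4, and T > 4. *)
have ab : 1 <= al * be.
  have T4 : 0 < (m + n) ^+ 2 - 4 by nra.
  rewrite -(ler_pM2r T4) mul1r; move: K.
  rewrite (_ : _ - _ = (m + n) ^+ 2 + (al ^+ 2 + be ^+ 2) * (1 - m * n) +
    al * be * (2 + 2 * (m * n) - (m + n) ^+ 2)); last by ring.
  by rewrite mn; lra.
have al0 : 0 < al by nra.
have be0 : 0 < be by nra.
have st : 0 <= s * t by lra.
have bV : al^-1 <= be by rewrite -(ler_pM2l al0) mulfV ?lt0r_neq0.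
(* The off-diagonal entries satisfy s t = al be - 1 >= 0; conjugation by diag (1, e) makes both
   nonnegative and leaves diagonal matrices fixed. *)
have [e [ee es et]] : exists e, [/\ e * e = 1, 0 <= e * s & 0 <= e * t].
  have [s0|s0|s0] := ltgtP 0 s.
  - by exists 1; rewrite mulr1 !mul1r; split=> //; [lra|rewrite -(pmulr_rge0 _ s0)].
  - by exists (-1); rewrite mulrNN mulr1 !mulN1r; split=> //; [lra|nra].
  - rewrite -s0; have [t0|t0] := leP 0 t.
      by exists 1; rewrite mulr1 mulr0 mul1r.
    by exists (-1); rewrite mulrNN mulr1 mulr0 mulN1r; split=> //; lra.
pose J := mx2 1 0 0 e.
have [j1 j2 j3 j4] := mx2E 1 0 0 e.
have [i1 i2 i3 i4] := mx2_1E R.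
have JJ : J *m J = 1%:M.
  by apply: mx2P; rewrite mulmx2E ?i1 ?i2 ?i3 ?i4 ?j1 ?j2 ?j3 ?j4; lra.
have cJ A : mxconj (J *m P) (Q *m J) A = J *m mxconj P Q A *m J.
  by rewrite /mxconj !mulmxA.
exists (J *m P), (Q *m J), (ln al); split.
- by rewrite mulmxA -(mulmxA Q) JJ mulmx1.
- rewrite cJ CE; apply: mx2P; rewrite !mulmx2E ?j1 ?j2 ?j3 ?j4 ?d1 ?d2 ?d3 ?d4; try lra.
  by transitivity (n * (e * e)); [ring|rewrite ee mulr1].
- rewrite cJ -/X'; clearbody X'; rewrite /good !mulmx2E j1 j2 j3 j4
    alE beE sE tE expRN lnK ?posrE //.
  split; try lra.
  rewrite (_ : _ + _ = be * (e * e)); last by ring.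
  by rewrite ee mulr1.
Qed.

End Good.

(** * Supporting functionals *)

Lemma convex_comb_affine (F : realFieldType) (t r s u v f g : F) :
  0 <= t -> 0 <= 1 - t -> u * r + v <= f -> u * s + v <= g ->
  u * (t * r + (1 - t) * s) + v <= t * f + (1 - t) * g.
Proof.
move=> t0 t1 hf hg; have := lerD (ler_wpM2l t0 hf) (ler_wpM2l t1 hg).
by congr (_ <= _); ring.
Qed.

Lemma convex_comb_itv (F : realFieldType) (t r s b : F) : 0 < t -> 0 < 1 - t ->
  0 <= r <= b -> 0 <= s <= b -> r != s -> 0 < t * r + (1 - t) * s < b.
Proof.
wlog rs : t r s / r < s.
  move=> wl t0 t1 hr hs rs.
  have [lt|lt] : r < s \/ s < r by apply/orP; rewrite -neq_lt.
    exact: wl.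
  have := wl (1 - t) s r lt t1; rewrite opprB addrCA subrr addr0 addrC.
  by apply=> //; rewrite eq_sym.
move=> t0 t1 /andP[r0 _] /andP[_ s1] _; apply/andP; split.
  by rewrite ltr_wpDl ?mulr_gt0 ?mulr_ge0 ?(ltW t0) //; apply: le_lt_trans rs.
have : t * r < t * s by rewrite ltr_pM2l.
by lra.
Qed.

Lemma convex_comb_between (F : realFieldType) (s r b : F) : s < r -> r < b ->
  exists t, [/\ 0 < t, 0 < 1 - t & r = t * s + (1 - t) * b].
Proof.
move=> sr rb; have d0 : 0 < b - s by lra.
exists ((b - r) / (b - s)); split; last by field; lra.
  by rewrite divr_gt0 // subr_gt0.
by rewrite subr_gt0 ltr_pdivrMr //; lra.
Qed.

Lemma convex_comb_lt (F : realFieldType) (t f g : F) : 0 < 1 - t -> g < f ->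
  t * f + (1 - t) * g < f.
Proof.
by move=> t1 gf; have : (1 - t) * g < (1 - t) * f; [rewrite ltr_pM2l|lra].
Qed.

(** * Words of Farey fractions and their matrices *)

Section Words.
Variables (R : realType) (a : nat).
Hypothesis a_gt0 : (0 < a)%N.

Definition word (x y : nat) := mh_word a (x%:R / y%:R).

Lemma farey_root : farey 0 1 1 2.
Proof. by []. Qed.

Lemma word01 : word 0 1 = [:: a; a].
Proof. by rewrite /word mul0r mh_word0. Qed.

Lemma word12 : word 1 2 = [:: (2 * a)%N; (2 * a)%N].
Proof. exact: mh_word_half. Qed.

Lemma word_mediant p q p' q' : farey p q p' q' ->
  word (p + p') (q + q') = word p' q' ++ word p q.
Proof. by case=> d q0 q'0 le2; exact: mh_word_mediant. Qed.

Lemma word_ind (P : nat -> nat -> Prop) : P 0%N 1%N -> P 1%N 2%N ->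
  (forall p q p' q', farey p q p' q' -> P p q -> P p' q' ->
     P (p + p')%N (q + q')%N) ->
  forall x y, coprime x y -> (0 < y)%N -> (2 * x <= y)%N -> P x y.
Proof.
move=> P0 P1 Pm x y cxy y0 le2.
by apply: (farey_ind Pm farey_root P0 P1); lia.
Qed.

Lemma word_paired x y : coprime x y -> (0 < y)%N -> (2 * x <= y)%N ->
  paired (word x y).
Proof.
move: x y; apply: word_ind => [||p q p' q' F pp pp'].
- by rewrite word01; constructor.
- by rewrite word12; constructor; lia.
- by rewrite word_mediant //; constructor.
Qed.

Lemma word_sumn x y : coprime x y -> (0 < y)%N -> (2 * x <= y)%N ->
  sumn (word x y) = (2 * a * y)%N.
Proof.
move: x y; apply: word_ind => [||p q p' q' F e e'].
- by rewrite word01 /=; lia.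
- by rewrite word12 /=; lia.
- by rewrite word_mediant // sumn_cat e e'; lia.
Qed.

Definition word_mx x y : 'M[R]_2 :=
  map_mx (GRing.natmul 1) (cf_mx (word x y)).

Lemma word_mxE x y i j : word_mx x y i j = (cf_mx (word x y) i j)%:R.
Proof. by rewrite mxE. Qed.

Lemma word_mx_mediant p q p' q' : farey p q p' q' ->
  word_mx (p + p') (q + q') = word_mx p' q' *m word_mx p q.
Proof. by move=> F; rewrite /word_mx word_mediant // cf_mx_cat map_mxM. Qed.

Lemma word_mx_trace x y : tr2 (word_mx x y) = cf_trace R (word x y).
Proof. by rewrite /tr2 !word_mxE. Qed.

Definition word_log x y : R := cf_log R (word x y).

Lemma word_logE x y : word_log x y = spec_log (tr2 (word_mx x y)).
Proof. by rewrite word_mx_trace. Qed.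

Lemma word_mx_det x y : paired (word x y) -> det2 (word_mx x y) = 1.
Proof. by move=> pw; rewrite /det2 !word_mxE (cf_mx_detR R pw); ring. Qed.

Lemma word_mx_gt2 x y : paired (word x y) -> 2 < tr2 (word_mx x y).
Proof. by move=> pw; rewrite word_mx_trace cf_trace_gt2. Qed.

Lemma word_mx10_gt0 x y : paired (word x y) -> 0 < word_mx x y 1 0.
Proof. by move=> pw; rewrite word_mxE ltr0n cf_mx_gt0. Qed.

Lemma farey_paired p q p' q' : farey p q p' q' ->
  [/\ paired (word p q), paired (word p' q') & paired (word (p + p') (q + q'))].
Proof.
move=> F; have [d q0 q'0 le2] := F; have [c c'] := farey_coprime F.
have [cm _] := farey_coprime (farey_right F).
have le1 : (2 * p <= q)%N by rewrite -(leq_pmul2r q'0); nia.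
by split; apply: word_paired => //; lia.
Qed.

(** The value is 4 - 4 a^6; [fricke_mull] and [fricke_mulr] carry the bound down the tree. *)
Lemma fricke_root : fricke (word_mx 0 1) (word_mx 1 2) <= 4.
Proof.
rewrite /fricke /tr2 !mulmx2E !word_mxE word01 word12.
have [-> -> -> ->] := cf_mx2E a a; have [-> -> -> ->] := cf_mx2E (2 * a) (2 * a).
rewrite !natrD !natrM.
have a1 : 0 <= a%:R :> R by [].
move: (a%:R : R) a1 => x x0.
rewrite (_ : _ - _ = 4 - 4 * x ^+ 6); last by ring.
by have := exprn_ge0 6 x0; lra.
Qed.

(** * Linear lower bounds for the log of the spectral radius *)

Definition lin (s t : R) (x y : nat) : R := s * x%:R + t * y%:R.

Lemma linD s t x x' y y' : lin s t (x + x') (y + y') = lin s t x y + lin s t x' y'.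
Proof. by rewrite /lin !natrD; ring. Qed.

(** At a mediant the matrices multiply and [lin] adds, as [good_mul] requires. *)
Lemma good_between P Q e s t p q p' q' : Q *m P = 1%:M -> e * e = 1 ->
  farey p q p' q' ->
  good e (mxconj P Q (word_mx p q)) (lin s t p q) ->
  good e (mxconj P Q (word_mx p' q')) (lin s t p' q') ->
  forall x y, coprime x y -> (0 < y)%N -> (p * y <= x * q)%N ->
    (x * q' <= p' * y)%N -> good e (mxconj P Q (word_mx x y)) (lin s t x y).
Proof.
move=> QP ee; apply: farey_ind => b d b' d' F g g'.
by rewrite word_mx_mediant // mxconjM // linD addrC; apply: good_mul.
Qed.

(** Starts from the interval whose mediant is x/y, in a basis diagonalising the matrix of x/y, and
    enlarges the interval step by step. The same basis and functional are kept, and each newly added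
    end is recovered by [good_divl] or [good_divr]. *)
Lemma support_in x y : coprime x y -> (0 < y)%N ->
  forall p q p' q', farey p q p' q' -> (p * y < x * q)%N -> (x * q' < p' * y)%N ->
  fricke (word_mx p q) (word_mx p' q') <= 4 ->
  exists P Q s t, [/\ Q *m P = 1%:M,
    word_log x y = lin s t x y,
    forall x' y', coprime x' y' -> (0 < y')%N -> (p * y' <= x' * q)%N ->
      (x' * y <= x * y')%N -> good 1 (mxconj P Q (word_mx x' y')) (lin s t x' y') &
    forall x' y', coprime x' y' -> (0 < y')%N -> (x * y' <= x' * y)%N ->
      (x' * q' <= p' * y')%N ->
      good (-1) (mxconj P Q (word_mx x' y')) (lin s t x' y')].
Proof.
have ee : (-1) * (-1) = 1 :> R by rewrite mulrNN mulr1.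
have ee1 : 1 * 1 = 1 :> R by rewrite mulr1.
move=> cxy y0; apply: farey_rec => // p q p' q' F.
- move=> xE yE K.
  have [p1 p2 p3] := farey_paired F.
  have CE := word_mx_mediant F.
  have tX : 0 < tr2 (word_mx p q) by apply: lt_trans (word_mx_gt2 p1).
  have KC : fricke (word_mx p q) (word_mx (p + p') (q + q')) <= 4.
    by rewrite CE fricke_mull // word_mx_det.
  have [P [Q [l [QP DE g]]]] := good_basis (word_mx_det p3) (word_mx_gt2 p3)
    (word_mx10_gt0 p3) (word_mx_det p1) tX KC.
  rewrite -word_logE in DE; set mu := word_log _ _ in DE.
  have [d q0 q'0 le2] := F.
  have dR : p'%:R * q%:R = p%:R * q'%:R + 1 :> R by rewrite -!natrM d natrD.
  (* [s] and [t] solve the system of determinant p' q - p q' = 1 that prescribes the values [l] at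
     (p, q) and [mu - l] at (p', q'), hence [mu] at the mediant. *)
  pose s := (mu - l) * q%:R - l * q'%:R.
  pose t := p'%:R * l - p%:R * (mu - l).
  have linp : lin s t p q = l.
    by transitivity (l * (p'%:R * q%:R - p%:R * q'%:R));
      [rewrite /lin /s /t; ring|rewrite dR; ring].
  have linp' : lin s t p' q' = mu - l.
    by transitivity ((mu - l) * (p'%:R * q%:R - p%:R * q'%:R));
      [rewrite /lin /s /t; ring|rewrite dR; ring].
  have linm : lin s t (p + p') (q + q') = mu by rewrite linD linp linp'; ring.
  have gm e : good e (mxconj P Q (word_mx (p + p') (q + q'))) (lin s t (p + p') (q + q')).
    by rewrite linm DE; exact: good_diag.
  have gp : good 1 (mxconj P Q (word_mx p q)) (lin s t p q) by rewrite linp.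
  have gp' : good (-1) (mxconj P Q (word_mx p' q')) (lin s t p' q').
    apply: (@good_divr _ _ (mxconj P Q (word_mx p q)) _ (lin s t p q)) => //.
    - by rewrite det2_conj // word_mx_det.
    - by rewrite -mxconjM // -word_mx_mediant // addrC -linD.
    - by rewrite opprK.
  exists P, Q, s, t; rewrite xE yE; split=> //.
  - exact: good_between QP ee1 (farey_left F) gp (gm 1).
  - exact: good_between QP ee (farey_right F) (gm (-1)) gp'.
- move=> lx gx IH K; have [p1 p2 p3] := farey_paired F.
  have [|P [Q [s [t [QP wE gl gr]]]]] := IH.
    by rewrite word_mx_mediant // fricke_mull // word_mx_det.
  exists P, Q, s, t; split=> //.
  have gm : good (-1) (mxconj P Q (word_mx (p + p') (q + q'))) (lin s t (p + p') (q + q')).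
    by apply: gr => //; [case: (farey_coprime (farey_right F))|case: F; lia|lia].
  have gp : good 1 (mxconj P Q (word_mx p q)) (lin s t p q).
    by apply: gl => //; [case: (farey_coprime F)|case: F|lia].
  (* The known interval ends at the mediant, which lies right of x/y; the matrix of the added end
     p'/q' is that of the mediant times the inverse of that of p/q. *)
  have gp' : good (-1) (mxconj P Q (word_mx p' q')) (lin s t p' q').
    apply: (@good_divr _ _ (mxconj P Q (word_mx p q)) _ (lin s t p q)) => //.
    - by rewrite det2_conj // word_mx_det.
    - by rewrite -mxconjM // -word_mx_mediant // addrC -linD.
    - by rewrite opprK.
  move=> x' y' cxy' y'0 lx' gx'.
  case: (leqP (x' * (q + q')) ((p + p') * y')) => h; first exact: gr.
  exact: (good_between QP ee (farey_right F) gm gp' cxy' y'0 (ltnW h)).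
- move=> lx gx IH K; have [p1 p2 p3] := farey_paired F.
  have [|P [Q [s [t [QP wE gl gr]]]]] := IH.
    by rewrite word_mx_mediant // fricke_mulr // word_mx_det.
  exists P, Q, s, t; split=> //.
  have gm : good 1 (mxconj P Q (word_mx (p + p') (q + q'))) (lin s t (p + p') (q + q')).
    by apply: gl => //; [case: (farey_coprime (farey_right F))|case: F; lia|lia].
  have gp' : good (-1) (mxconj P Q (word_mx p' q')) (lin s t p' q').
    by apply: gr => //; [case: (farey_coprime F)|case: F|lia].
  have gp : good 1 (mxconj P Q (word_mx p q)) (lin s t p q).
    apply: (@good_divl _ _ _ (mxconj P Q (word_mx p' q')) _ (lin s t p' q')) => //.
    - by rewrite det2_conj // word_mx_det.
    - by rewrite -mxconjM // -word_mx_mediant // addrC -linD.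
  move=> x' y' cxy' y'0 lx' gx'.
  case: (leqP ((p + p') * y') (x' * (q + q'))) => h; first exact: gl.
  exact: (good_between QP ee1 (farey_left F) gp gm cxy' y'0 _ (ltnW h)).
Qed.

(** The trace is invariant under conjugation, so [good_trace] applies to the fractions on either
    side of x/y. *)
Lemma support x y : coprime x y -> (0 < x)%N -> (2 * x < y)%N ->
  exists s t, word_log x y = lin s t x y /\
    forall x' y', coprime x' y' -> (0 < y')%N -> (2 * x' <= y')%N ->
      lin s t x' y' <= word_log x' y'.
Proof.
move=> cxy x0 le2; have y0 : (0 < y)%N by lia.
have [||P [Q [s [t [QP wE gl gr]]]]] := support_in cxy y0 farey_root _ _ fricke_root.
- by lia.
- by lia.
exists s, t; split=> // x' y' cxy' y'0 le2'.
rewrite word_logE -(tr2_conj _ QP).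
case: (leqP (x' * y) (x * y')) => h.
  by apply: (@good_trace _ 1); apply: gl => //; lia.
by apply: (@good_trace _ (-1)); apply: gr => //; lia.
Qed.

(* In the orthogonal eigenbasis (1, lam), (- lam, 1) of the matrix of [2a, 2a],
   whose eigenvalue for (1, lam) is lam ^ 2, the diagonal entry of the matrix of
   [a, a] exceeds lam. *)
Lemma word_log_gt x y : coprime x y -> (0 < y)%N -> (2 * x < y)%N ->
  word_log 1 2 / 2 * y%:R < word_log x y.
Proof.
move=> cxy y0 le2.
have lx : (0 * y <= x * 1)%N by lia.
have gx : (x * 2 <= 1 * y)%N by lia.
have w12 : paired (word 1 2) by rewrite word12; constructor; lia.
set A : R := a%:R; have A1 : 1 <= A by rewrite ler1n.
pose r := Num.sqrt (A ^+ 2 + 1); have r0 : 0 <= r by exact: sqrtr_ge0.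
have r2 : r ^+ 2 = A ^+ 2 + 1 by rewrite sqr_sqrtr // addr_ge0 ?sqr_ge0.
(* [k] is the positive root of k^2 = 2 a k + 1, so 1/k = k - 2 a, and k^2 + k^-2 = 4 a^2 + 2 is the
   trace at 1/2. *)
pose k := A + r; have k0 : 0 < k by rewrite /k; lra.
have kE : k ^+ 2 = 2 * A * k + 1 by rewrite /k; nra.
have kV : k^-1 = k - 2 * A.
  by apply: (mulfI (lt0r_neq0 k0)); rewrite mulfV ?lt0r_neq0 //; nra.
have word_mx_sq b x' y' : word x' y' = [:: b; b] ->
    [/\ word_mx x' y' 0 0 = 1, word_mx x' y' 0 1 = b%:R, word_mx x' y' 1 0 = b%:R
      & word_mx x' y' 1 1 = b%:R ^+ 2 + 1].
  move=> e; rewrite !word_mxE e; have [-> -> -> ->] := cf_mx2E b b.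
  by rewrite natrD natrM expr2.
have [u1 u2 u3 u4] := word_mx_sq _ _ _ word01; rewrite -/A in u1 u2 u3 u4.
have [v1 v2 v3 v4] := word_mx_sq _ _ _ word12; rewrite natrM -/A in v2 v3 v4.
have ar : A < r by rewrite -ltr_sqr ?nnegrE ?r2; lra.
have k2 : 2 < k by rewrite /k; lra.
pose l := 2 * ln k; have l0 : 0 <= l by rewrite mulr_ge0 // ln_ge0 //; lra.
have el : expR l = k ^+ 2 by rewrite /l mulrC expRM_natr lnK.
have l12 : word_log 1 2 = l.
  rewrite word_logE -[RHS]spec_log_eq //; congr spec_log.
  by rewrite expRN el -exprVn kV /tr2 v1 v4; nra.
have n0 : 0 < 1 + k ^+ 2 by rewrite ltr_pwDl // sqr_ge0.
have nn0 : 1 + k ^+ 2 != 0 by exact: lt0r_neq0.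
pose P := mx2 1 k (- k) 1.
have [p1 p2 p3 p4] := mx2E 1 k (- k) 1.
pose n := (1 + k ^+ 2)^-1.
have nE : n * (1 + k ^+ 2) = 1 by rewrite mulVf.
pose Q := mx2 n (- k * n) (k * n) n.
have [q1 q2 q3 q4] := mx2E n (- k * n) (k * n) n.
have [i1 i2 i3 i4] := mx2_1E R.
have QP : Q *m P = 1%:M.
  by apply: mx2P; rewrite mulmx2E ?i1 ?i2 ?i3 ?i4 ?p1 ?p2 ?p3 ?p4 ?q1 ?q2 ?q3 ?q4; nra.
have PQ : P *m Q = 1%:M.
  by apply: mx2P; rewrite mulmx2E ?i1 ?i2 ?i3 ?i4 ?p1 ?p2 ?p3 ?p4 ?q1 ?q2 ?q3 ?q4; nra.
have [d1 d2 d3 d4] := mx2E (expR l) 0 0 (expR l)^-1.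
have VE : mxconj P Q (word_mx 1 2) = mx2 (expR l) 0 0 (expR l)^-1.
  rewrite /mxconj.
  suff -> : P *m word_mx 1 2 = mx2 (expR l) 0 0 (expR l)^-1 *m P.
    by rewrite -mulmxA PQ mulmx1.
  apply: mx2P; rewrite !mulmx2E ?d1 ?d2 ?d3 ?d4 ?v1 ?v2 ?v3 ?v4 ?p1 ?p2 ?p3 ?p4 el
    -?exprVn ?kV; nra.
pose al := (1 + 2 * A * k + k ^+ 2 * (A ^+ 2 + 1)) * n.
pose be := (- k + A - A * k ^+ 2 + k * (A ^+ 2 + 1)) * n.
set U := mxconj P Q (word_mx 0 1).
have U00 : U 0 0 = al.
  by rewrite /U /mxconj !mulmx2E p1 p2 q1 q3 u1 u2 u3 u4 /al; ring.
have U01 : U 0 1 = be.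
  by rewrite /U /mxconj !mulmx2E p1 p2 q2 q4 u1 u2 u3 u4 /be; ring.
have U10 : U 1 0 = be.
  by rewrite /U /mxconj !mulmx2E p3 p4 q1 q3 u1 u2 u3 u4 /be; ring.
have detU : U 0 0 * U 1 1 - U 0 1 * U 1 0 = 1.
  by rewrite -/(det2 U) det2_conj // word_mx_det // word01; constructor.
have alk : k < al.
  (* Using k^2 = 2 A k + 1 twice, the claim becomes 2 k + 2 A k^2 < (A^2 + 2) k^2. It follows from
     (A - 1)^2 k^2 >= 0 and 2 k < k^2. *)
  rewrite /al ltr_pdivlMr //.
  rewrite (_ : 1 + 2 * A * k = k ^+ 2); last by rewrite kE; ring.
  have e3 : k * k ^+ 2 = 2 * A * k ^+ 2 + k by rewrite {1}kE; ring.
  have kk : 2 * k < k ^+ 2 by rewrite expr2 ltr_pM2r.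
  have : 0 <= k ^+ 2 * (A - 1) ^+ 2 by rewrite mulr_ge0 // sqr_ge0.
  by lra.
have al0 : 0 < al by lra.
(* The conjugated matrix [U] is symmetric, so one sign handles both off-diagonal entries. *)
have [e [ee eb]] : exists e : R, e * e = 1 /\ 0 <= e * be.
  have [b0|b0] := leP 0 be; first by exists 1; rewrite !mul1r.
  by exists (-1); rewrite mulrNN mulr1 mulN1r; split=> //; lra.
have gU : good e U (ln al).
  rewrite /good expRN lnK ?posrE // U00 U01 U10; split=> //.
  rewrite -(ler_pM2l al0) mulfV ?lt0r_neq0 //.
  by have := sqr_ge0 be; move: detU; rewrite U00 U01 U10 expr2; lra.
pose t := ln al; pose s := l - 2 * t.
have lkt : ln k < t by rewrite ltr_ln.
have g : good e (mxconj P Q (word_mx x y)) (lin s t x y).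
  apply: (good_between QP ee farey_root _ _ cxy y0 lx gx).
  - by rewrite (_ : lin s t 0 1 = ln al) //; rewrite /lin /s /t; ring.
  - rewrite (_ : lin s t 1 2 = l); last by rewrite /lin /s /t; ring.
    by rewrite VE; exact: good_diag.
rewrite [ltRHS]word_logE -(tr2_conj _ QP).
apply: lt_le_trans (good_trace g).
(* The difference of the two sides is (t - l/2) (y - 2 x), where l/2 = ln k < t. *)
have yx : 0 < y%:R - 2 * x%:R :> R by rewrite subr_gt0 -natrM ltr_nat.
by rewrite l12 /lin /s /l; nra.
Qed.

(** * The numbers x(a, p/q) decrease weakly with p/q *)

Lemma cf_map_attract s (t : R) : paired s -> 0 <= t ->
  (t <= cf_map s t -> t <= periodic_cf R s) /\
  (cf_map s t <= t -> periodic_cf R s <= t).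
Proof.
move=> ps t0; have [fx /andP[x0 _]] := periodic_cf_fix R ps.
(* A point on the wrong side of the fixed point would be moved strictly towards it, against [h]. *)
set x := periodic_cf R s in fx x0 *; split=> h; rewrite leNgt; apply/negP => tx.
  by have /andP[_] := cf_map_contract ps x0 (ltW tx); rewrite fx; lra.
by have /andP[_] := cf_map_contract ps t0 (ltW tx); rewrite fx; lra.
Qed.

Lemma periodic_cf_anti x y x' y' : coprime x y -> coprime x' y' ->
  (0 < y)%N -> (0 < y')%N -> (2 * x' <= y')%N -> (x * y' <= x' * y)%N ->
  periodic_cf R (word x' y') <= periodic_cf R (word x y).
Proof.
move=> cxy cxy' y0 y'0 le2 lxx'.
apply: (@farey_homo R (fun x y => periodic_cf R (word x y)) (fun u v => v <= u) _ _ _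
  _ _ _ _ farey_root _ _ _ _ _ cxy cxy' y0 y'0) => //; try lia.
- by move=> u v w vu wv; apply: le_trans wv vu.
- move=> b d b' d' F; have [p1 p2 p3] := farey_paired F.
  have [f1 /andP[x1 _]] := periodic_cf_fix R p1.
  have [f2 /andP[x2 _]] := periodic_cf_fix R p2.
  rewrite word_mediant //; move: p1 p2 p3 f1 f2 x1 x2; rewrite word_mediant //.
  move: (word b d) (word b' d') => u v pu pv pvu.
  set xu := periodic_cf R u; set xv := periodic_cf R v => f1 f2 x1 x2 le0.
  split.
    (* The map of [v ++ u] first fixes [xu], then [v] moves it down towards [xv]. At [xv], below,
       [u] moves the point up first and [v] preserves the order. *)
    apply: (proj2 (cf_map_attract pvu x1)); rewrite cf_map_cat f1.
    by have /andP[] := cf_map_contract pv x2 le0; rewrite f2; lra.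
  apply: (proj1 (cf_map_attract pvu x2)); rewrite cf_map_cat -{1}f2 -subr_ge0.
  have h : xv <= cf_map u xv.
    by have /andP[_] := cf_map_contract pu x2 le0; rewrite f1; lra.
  by have /andP[] := cf_map_contract pv x2 h.
- rewrite word01 word12.
  have pu : paired [:: a; a] by constructor.
  have pv : paired [:: 2 * a; 2 * a]%N by constructor; lia.
  have [fx /andP[x0 _]] := periodic_cf_fix R pu.
  apply: (proj2 (cf_map_attract pv x0)); rewrite -[leRHS]fx.
  move: (periodic_cf R _) x0 => t t0.
  have a1 : 1 <= a%:R :> R by rewrite ler1n.
  rewrite /cf_map /= natrM; move: (a%:R : R) a1 => A A1.
  have i1 : 0 < (A + t)^-1 by rewrite invr_gt0; lra.
  have i2 : 0 < (2 * A + t)^-1 by rewrite invr_gt0; lra.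
  rewrite lef_pV2 ?posrE; [|lra|lra].
  (* As A >= 1, doubling the outer letter adds at least 1, which outweighs the change of the inner
     fraction. *)
  have i3 : (A + t)^-1 <= 1 by rewrite invf_le1; lra.
  lra.
Qed.

(** * Convexity and monotonicity on rational arguments *)

Lemma half_interval_frac r : half_interval r ->
  exists x y, [/\ coprime x y, (0 < y)%N, (2 * x <= y)%N & r = x%:R / y%:R].
Proof.
move=> /andP[r0 r1]; exists `|numq r|%N, `|denq r|%N.
have n0 : 0 <= numq r by rewrite numq_ge0.
have rE : r = `|numq r|%N%:R / `|denq r|%N%:R.
  rewrite -{1}[r]divq_num_den -{1}(gez0_abs n0).
  by rewrite -{1}(gez0_abs (ltW (denq_gt0 r))).
have y0 : (0 < `|denq r|)%N by rewrite absz_gt0 denq_neq0.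
split=> //; first exact: coprime_num_den.
move: r1; rewrite {1}rE ler_pdivrMr ?ltr0n // mulrC mulrA mulr1 ler_pdivlMr ?ltr0n //.
by rewrite -natrM ler_nat mulnC.
Qed.

Definition lyap r : R := Lyapunov (mh_number R a r).

Lemma lyapE x y : coprime x y -> (0 < y)%N -> (2 * x <= y)%N ->
  lyap (x%:R / y%:R) = word_log x y / (2 * a%:R * y%:R).
Proof.
move=> cxy y0 le2.
rewrite /lyap /mh_number (Lyapunov_periodic R (word_paired cxy y0 le2)).
by rewrite word_sumn // !natrM.
Qed.

(** Division by the length 2 a y turns a linear form in (x, y) into an affine function of x/y. *)
Lemma lyap_support w : 0 < w < 1 / 2 -> exists s t, lyap w = s * ratr w + t /\
  forall r, half_interval r -> s * ratr r + t <= lyap r.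
Proof.
move=> /andP[w0 w1].
have a1 : 0 < a%:R :> R by rewrite ltr0n.
have linE (s t : R) x y : (0 < y)%N -> lin s t x y / (2 * a%:R * y%:R) =
    s / (2 * a%:R) * ratr (x%:R / y%:R) + t / (2 * a%:R).
  move=> y0; have y1 : 0 < y%:R :> R by rewrite ltr0n.
  by rewrite fmorph_div /= !ratr_nat /lin; field; rewrite (lt0r_neq0 a1) (lt0r_neq0 y1).
have hw : half_interval w by rewrite /half_interval !ltW.
have [x [y [cxy y0 le2 wE]]] := half_interval_frac hw.
have y1 : 0 < y%:R :> rat by rewrite ltr0n.
have x0 : (0 < x)%N.
  by move: w0; rewrite wE; case: x {wE cxy le2} => //; rewrite mul0r ltxx.
have lt2 : (2 * x < y)%N.
  move: w1; rewrite wE ltr_pdivrMr // mulrC mulrA mulr1 ltr_pdivlMr //.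
  by rewrite -natrM ltr_nat mulnC.
have [s [t [wl sup]]] := support cxy x0 lt2.
exists (s / (2 * a%:R)), (t / (2 * a%:R)); split.
  by rewrite wE lyapE // wl linE.
move=> r /half_interval_frac [x' [y' [cxy' y'0 le2' ->]]].
rewrite lyapE // -linE // ler_pM2r; first exact: sup.
by rewrite invr_gt0 !mulr_gt0 // ltr0n.
Qed.

Lemma lyap_gt r : 0 <= r < 1 / 2 -> lyap (1 / 2) < lyap r.
Proof.
move=> /andP[r0 r1].
have hr : half_interval r by rewrite /half_interval r0 ltW.
have [x [y [cxy y0 le2 rE]]] := half_interval_frac hr.
have lt2 : (2 * x < y)%N.
  move: r1; rewrite rE ltr_pdivrMr ?ltr0n // mulrC mulrA mulr1 ltr_pdivlMr //.
  by rewrite -natrM ltr_nat mulnC.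
have a1 : 0 < a%:R :> R by rewrite ltr0n.
have y1 : 0 < y%:R :> R by rewrite ltr0n.
rewrite rE lyapE // (lyapE (x := 1) (y := 2)) //.
rewrite ltr_pdivlMr ?mulr_gt0 //.
apply: le_lt_trans (word_log_gt cxy y0 lt2); rewrite le_eqVlt; apply/orP; left.
by apply/eqP; field; rewrite (lt0r_neq0 a1).
Qed.

Lemma lyap_convex r s t : half_interval r -> half_interval s -> 0 <= t <= 1 ->
  lyap (t * r + (1 - t) * s) <= ratr t * lyap r + (1 - ratr t) * lyap s.
Proof.
move=> hr hs /andP[t0 t1].
(* Once the degenerate cases are settled, the convex combination lies strictly between 0 and 1/2,
   where a supporting function exists. *)
have [->|rs] := eqVneq r s.
  by rewrite -mulrDl addrCA subrr addr0 mul1r -mulrDl addrCA subrr addr0 mul1r lexx.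
have [->|tn0] := eqVneq t 0.
  by rewrite (rmorph0 (ratr : rat -> R)) !mul0r !add0r !subr0 !mul1r lexx.
have [->|tn1] := eqVneq t 1.
  by rewrite rmorph1 !mul1r !subrr !mul0r !addr0 lexx.
have {}t0 : 0 < t by rewrite lt0r tn0.
have {}t1 : 0 < 1 - t by rewrite subr_gt0 lt_neqAle tn1.
have [/andP[r0 r1] /andP[s0 s1]] := (hr, hs).
have w01 := convex_comb_itv t0 t1 hr hs rs.
have [u [v [-> sup]]] := lyap_support w01.
have hr' := sup r hr; have hs' := sup s hs.
rewrite rmorphD !rmorphM rmorphB rmorph1 /=.
have T0 : 0 <= ratr t :> R by rewrite ler0q ltW.
have T1 : 0 <= 1 - ratr t :> R by rewrite -(rmorph1 (ratr : rat -> R)) -rmorphB ler0q ltW.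
move: T0 T1 hr' hs'; move: (ratr t : R) (ratr r : R) (ratr s : R) (lyap r) (lyap s).
by move=> T x y f g; exact: convex_comb_affine.
Qed.

(** For r < 1/2, r is a proper convex combination of s and 1/2; convexity and the smaller value at
    1/2 give the strict inequality. *)
Lemma lyap_decr r s : half_interval r -> half_interval s -> s < r ->
  lyap r < lyap s.
Proof.
move=> hr hs sr; have [/andP[r0 r1] /andP[s0 s1]] := (hr, hs).
have s2 : s < 1 / 2 by apply: lt_le_trans r1.
have ls : lyap (1 / 2) < lyap s by apply: lyap_gt; rewrite s0.
have [->//|rn] := eqVneq r (1 / 2).
have {}r1 : r < 1 / 2 by rewrite lt_neqAle rn.
have [t [t0 t1 rE]] := convex_comb_between sr r1.
have hh : half_interval (1 / 2) by [].
rewrite {1}rE; apply: le_lt_trans (lyap_convex hs hh _) _.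
  by rewrite (ltW t0) -subr_ge0 ltW.
have T1 : 0 < 1 - ratr t :> R.
  by rewrite -(rmorph1 (ratr : rat -> R)) -rmorphB ltr0q.
move: T1 ls; move: (ratr t : R) (lyap s) (lyap (1 / 2)) => T f g T1 gf.
exact: convex_comb_lt.
Qed.

End Words.

Theorem theorem11 (R : realType) (a : nat) (ha : (1 <= a)%N) :
  (forall r s t : rat,
     half_interval r -> half_interval s -> 0 <= t <= 1 ->
     Lyapunov (mh_number R a (t * r + (1 - t) * s)) <=
       ratr t * Lyapunov (mh_number R a r) +
       (1 - ratr t) * Lyapunov (mh_number R a s)) /\
  (forall x y : R,
     mh_set R a x -> mh_set R a y -> x < y -> Lyapunov x < Lyapunov y).
Proof.
split; first by move=> r s t; exact: lyap_convex.
move=> _ _ [r hr ->] [s hs ->] lt_rs.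
(* Both functions of p/q decrease: x(a, r) < x(a, s) forces s < r, since r <= s would give the
   reverse weak inequality. *)
rewrite -!/(lyap R a _); apply: (lyap_decr R ha hr hs); rewrite ltNge.
apply/negP => rs; move: lt_rs.
have [x [y [cxy y0 le2 rE]]] := half_interval_frac hr.
have [x' [y' [cxy' y'0 le2' sE]]] := half_interval_frac hs.
have lxx' : (x * y' <= x' * y)%N.
  move: rs; rewrite rE sE ler_pdivrMr ?ltr0n // mulrAC ler_pdivlMr ?ltr0n //.
  by rewrite -!natrM ler_nat.
rewrite ltNge => /negP; apply; rewrite rE sE.
exact: (periodic_cf_anti R ha cxy cxy' y0 y'0 le2' lxx').
Qed.
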